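(* Under the setting and assumptions described in the context (with $d=1$), let $\beta_0=\sup\{\beta:\ I(\beta)<\infty\}$ and suppose $0<\beta<\beta_0$. Then for $c=\frac{1}{I(\beta)}$, with probability one $$\lim_{n\to\infty}\ \max_{0\le k\le n-b_c(n)}V^c_{k,n}(1)=\beta .$$
   Context: Notation: $[x]$ is the integer part of $x$, and $\mathbb{N}=\{1,2,\dots\}$. Setting. Let $\wp,\ell\ge 1$ be integers, let $X_1,X_2,\dots$ be an $\mathbb{R}^{\wp}$-valued stationary stochastic process on a probability space $(\Omega,\mathcal{F},P)$, and let $F:\mathbb{R}^{\wp\ell}\to\mathbb{R}$ be a bounded Borel function, $F=F(x_1,\dots,x_\ell)$ with $x_i\in\mathbb{R}^\wp$ (i.e. $d=1$). Let $\mathcal{F}_{m,n}\subset\mathcal{F}$, $-\infty\le m\le n\le\infty$, be $\sigma$-algebras such that $\mathcal{F}_{m,n}\subset\mathcal{F}_{m_1,n_1}$ whenever $m_1\le m$ and $n_1\ge n$. Mixing assumption. There is $\kappa_1>0$ such that, for all $k,n\ge 0$, $$\psi(n)=\sup\Big\{\Big|\frac{P(A\cap B)}{P(A)P(B)}-1\Big|:\ A\in\mathcal{F}_{-\infty,k},\ B\in\mathcal{F}_{k+n,\infty},\ P(A)P(B)\neq 0\Big\}\le\kappa_1^{-1}e^{-\kappa_1 n}.$$ Centering assumption. With $\mu$ the distribution of $X_1$, $$\bar F=\int F(x_1,\dots,x_\ell)\,d\mu(x_1)\cdots d\mu(x_\ell)=0.$$ Regularity assumption. One of the following holds: (A) there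 is $m\in\mathbb{N}$ independent of $n$ such that $X_n$ is $\mathcal{F}_{n-m,n+m}$-measurable for every $n$ (and $F$ is only assumed bounded and Borel); or (B) $F$ is bounded and Hölder continuous, i.e. $\|F\|_\infty=D<\infty$ and, for some $\kappa_2>0$, $|F(x_1,\dots,x_\ell)-F(y_1,\dots,y_\ell)|\le\kappa_2^{-1}\sum_{i=1}^\ell|x_i-y_i|^{\kappa_2}$ for all arguments; and for some $\kappa_3>0$ and all $n,m\in\mathbb{N}$, $E|X_n-X_{n,m}|^{\kappa_2}\le\kappa_3^{-1}e^{-\kappa_3 m}$, where $X_{n,m}=E(X_n\mid\mathcal{F}_{n-m,n+m})$. Assumption on exponential moments. Let $\{X^{(i)}_k,\ k\ge 1\}$, $i=1,\dots,\ell$, be independent copies (in distribution) of the process $\{X_k,\ k\ge 1\}$. For every piecewise constant map $\gamma:[0,1]\to\mathbb{R}$ the limit $$\lim_{n\to\infty}\frac1n\ln E\exp\Big(n\int_0^1\gamma_u\,F(X^{(1)}_{[un]},X^{(2)}_{2[un]},\dots,X^{(\ell)}_{\ell[un]})\,du\Big)=\int_0^1\Pi(\gamma_u)\,du$$ exists, where $\Pi(\alpha)$, $\alpha\in\mathbb{R}$, is a convex twice differentiable function such that $\Pi'(0)=0$ and $\Pi''(0)>0$. (For $u$ with $[un]=0$ the term $F(\cdot)$ in the integrand is interpreted as $0$; since $F$ is bounded this does not affect the limit.) Rate function. For $\beta\in\mathbb{R}$ let $I(\beta)=\sup_{\alpha\in\mathbb{R}}\big(\alpha\beta-\Pi(\alpha)\big)\in[0,\infty]$.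 Nonconventional sums. Let $\Sigma_0=0$ and $\Sigma_n=\sum_{k=1}^nF(X_k,X_{2k},\dots,X_{\ell k})$. For $c>0$, $u\in[0,1]$ and integers $m\ge 0$, $n\ge 2$ set $b_c(n)=[c\ln n]$, $b_c(n,u)=[u\,b_c(n)]$ and $$V^c_{m,n}(u)=\frac{\Sigma_{m+b_c(n,u)}-\Sigma_m}{b_c(n)}$$ (considered for $n$ large enough that $b_c(n)\ge 1$); in particular $V^c_{m,n}(1)=\big(\Sigma_{m+b_c(n)}-\Sigma_m\big)/b_c(n)$. *)

(* Defs.v *)
From HB Require Import structures.
From mathcomp Require Import all_boot all_order all_algebra.
From mathcomp Require Import all_classical all_reals all_analysis.

Set Implicit Arguments.
Unset Strict Implicit.
Unset Printing Implicit Defensive.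

Import Order.TTheory GRing.Theory Num.Theory.
Import numFieldNormedType.Exports.

Local Open Scope classical_set_scope.
Local Open Scope ring_scope.

(* The space R^p is [p.-tuple R] and R^(p l) is [l.-tuple (p.-tuple R)]: the   *)
(* sigma-algebra of a tuple type is generated by the coordinates, so here it  *)
(* is the Borel one.  Processes are indexed by nat, but only the indices      *)
(* k >= 1 are ever used; the value at index 0 is irrelevant.                  *)

Definition edist (R : realType) (p : nat) (x y : p.-tuple R) : R :=
  Num.sqrt (\sum_(j < p) (tnth x j - tnth y j) ^+ 2).

Section processes.
Context d (Omega : measurableType d) (R : realType).
Context dT (T : measurableType dT).

Definition fidi (X : nat -> Omega -> T) (N : nat) (t : N.-tuple nat)
    (w : Omega) : N.-tuple T :=
  [tuple X (tnth t i) w | i < N].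

Definition stationary (P : probability Omega R) (X : nat -> Omega -> T) :=
  forall (N h : nat) (t : N.-tuple nat), (forall i, (1 <= tnth t i)%N) ->
  forall B : set (N.-tuple T), measurable B ->
    P (fidi X [tuple (tnth t i + h)%N | i < N] @^-1` B) = P (fidi X t @^-1` B).

Definition process_sigma (X : nat -> Omega -> T) : set (set Omega) :=
  <<s \bigcup_(k in [set k | (1 <= k)%N])
        preimage_set_system setT (X k) measurable >>.

Definition independent_processes (P : probability Omega R) (l : nat)
    (Y : 'I_l -> nat -> Omega -> T) :=
  forall (J : {set 'I_l}) (A : 'I_l -> set Omega),
    (forall i, i \in J -> process_sigma (Y i) (A i)) ->
    P (\bigcap_(i in [set` J]) A i) = (\prod_(i in J) P (A i))%E.

End processes.

Definition same_law d (Omega : measurableType d) d' (Omega' : measurableType d')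
    (R : realType) dT (T : measurableType dT)
    (P : probability Omega R) (Q : probability Omega' R)
    (X : nat -> Omega -> T) (Y : nat -> Omega' -> T) :=
  forall (N : nat) (t : N.-tuple nat), (forall i, (1 <= tnth t i)%N) ->
  forall B : set (N.-tuple T), measurable B ->
    Q (fidi Y t @^-1` B) = P (fidi X t @^-1` B).

(* iterated_integral mu f = \int \dots \int f(x_1, ..., x_l) dmu(x_l) ... dmu(x_1) *)
Fixpoint iterated_integral (R : realType) dT (T : measurableType dT)
    (mu : {measure set T -> \bar R}) (l : nat) : (l.-tuple T -> R) -> R :=
  match l with
  | 0 => fun f => f [tuple]
  | l'.+1 => fun f =>
      \int[mu]_x iterated_integral mu (fun t : l'.-tuple T => f [tuple of x :: t])
  end.

Section mixing.
Context d (Omega : measurableType d) (R : realType) (P : probability Omega R).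
Implicit Type Fm : \bar int -> \bar int -> set (set Omega).

Definition monotone_sigma_algebras Fm :=
  (forall m n, (m <= n)%E -> sigma_algebra setT (Fm m n)) /\
  (forall m n, (m <= n)%E -> Fm m n `<=` measurable) /\
  (forall m n m1 n1, (m <= n)%E -> (m1 <= m)%E -> (n <= n1)%E ->
     Fm m n `<=` Fm m1 n1).

Definition psi Fm (n : nat) : \bar R :=
  ereal_sup [set r | exists k A B,
    [/\ Fm -oo%E (k : nat)%:Z%:E A, Fm (k + n)%N%:Z%:E +oo%E B,
        (P A * P B)%E <> 0%E &
        r = `|fine (P (A `&` B)) / (fine (P A) * fine (P B)) - 1|%:E]].

Definition sub_measurable dT (T : measurableType dT) (G : set (set Omega))
    (X : Omega -> T) :=
  preimage_set_system setT X measurable `<=` G.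

(* Y is a version of E(Z | G) *)
Definition is_cond_exp (G : set (set Omega)) (Z Y : Omega -> R) :=
  [/\ P.-integrable setT (EFin \o Z), P.-integrable setT (EFin \o Y),
      sub_measurable G Y &
      forall A, G A -> (\int[P]_(w in A) (Y w)%:E = \int[P]_(w in A) (Z w)%:E)%E].

Definition is_cond_exp_tuple p (G : set (set Omega))
    (Z Y : Omega -> p.-tuple R) :=
  forall j : 'I_p,
    is_cond_exp G (fun w => tnth (Z w) j) (fun w => tnth (Y w) j).

Definition window Fm (n m : nat) : set (set Omega) :=
  Fm (n%:Z - m%:Z)%:E (n%:Z + m%:Z)%:E.

Definition regularityA Fm p (X : nat -> Omega -> p.-tuple R) :=
  exists2 m : nat, (1 <= m)%N &
    forall n, (1 <= n)%N -> sub_measurable (window Fm n m) (X n).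

Definition regularityB Fm p l (X : nat -> Omega -> p.-tuple R)
    (F : l.-tuple (p.-tuple R) -> R) :=
  exists2 kappa2 : R, 0 < kappa2 &
    (forall x y, `|F x - F y| <=
       kappa2^-1 * \sum_(i < l) edist (tnth x i) (tnth y i) `^ kappa2) /\
    (exists2 kappa3 : R, 0 < kappa3 &
       forall n m, (1 <= n)%N -> (1 <= m)%N ->
       exists2 Xnm : Omega -> p.-tuple R,
         is_cond_exp_tuple (window Fm n m) (X n) Xnm &
         ('E_P[fun w => (edist (X n w) (Xnm w) `^ kappa2)%R] <=
           (kappa3^-1 * expR (- kappa3 * m%:R))%:E)%E).

End mixing.

(* Constant on each open interval of a finite partition of [0, 1]; the values *)
(* at the partition points are free.                                          *)
Definition piecewise_constant (R : realType) (g : R -> R) :=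
  exists2 s : seq R, itv_partition 0 1 s &
    forall i, (i < size s)%N -> exists a : R,
      forall u, u \in `]nth 0 (0 :: s) i, nth 0 (0 :: s) i.+1[ -> g u = a.

Definition exponential_moments d (Omega : measurableType d) (R : realType)
    (Q : probability Omega R) p l (F : l.-tuple (p.-tuple R) -> R)
    (Y : 'I_l -> nat -> Omega -> p.-tuple R) (Pi : R -> R) :=
  let G k w := if k == 0%N then 0 else F [tuple Y i (i.+1 * k)%N w | i < l] in
  forall g : R -> R, piecewise_constant g ->
    (fun n : nat => n%:R^-1 *
       ln (fine 'E_Q[fun w => expR (n%:R *
         \int[lebesgue_measure]_(u in `[0, 1]) (g u * G (Num.truncn (u * n%:R)) w))]))
    @ \oo --> \int[lebesgue_measure]_(u in `[0, 1]) Pi (g u).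

Section rate.
Context (R : realType).
Implicit Type Pi : R -> R.

Definition admissible_Pi Pi :=
  [/\ convex_function [set: R^o] Pi,
      forall x : R, derivable Pi x 1,
      forall x : R, derivable (derive1 Pi) x 1,
      derive1 Pi 0 = 0 & 0 < derive1n 2 Pi 0].

Definition rate Pi (b : R) : \bar R :=
  ereal_sup [set (a * b - Pi a)%:E | a in [set: R]].

Definition beta0 Pi : \bar R :=
  ereal_sup [set b%:E | b in [set b | (rate Pi b < +oo)%E]].

End rate.

Section sums.
Context d (Omega : measurableType d) (R : realType) (p l : nat).
Variables (F : l.-tuple (p.-tuple R) -> R) (X : nat -> Omega -> p.-tuple R).

Definition Sigma (n : nat) (w : Omega) : R :=
  \sum_(1 <= k < n.+1) F [tuple X (i.+1 * k)%N w | i < l].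

Definition bc (c : R) (n : nat) : nat := Num.truncn (c * ln n%:R).

Definition bcu (c : R) (n : nat) (u : R) : nat := Num.truncn (u * (bc c n)%:R).

Definition V (c : R) (m n : nat) (u : R) (w : Omega) : R :=
  (Sigma (m + bcu c n u)%N w - Sigma m w) / (bc c n)%:R.

(* The maximum over 0 <= k <= n - bc c n.  The default of the iterated maximum *)
(* is its k = 0 term, so it adds nothing.  The subtraction on nat is exact     *)
(* once bc c n <= n, i.e. for all large n.                                     *)
Definition maxV (c : R) (n : nat) (w : Omega) : R :=
  \big[Order.max/V c 0 n 1 w]_(0 <= k < (n - bc c n).+1) V c k n 1 w.

End sums.

(* Main.v *)
(* For a window (k, k + b] whose start k is large compared with its length b,
   the l blocks of indices (k, k + b], ..., (l k, l (k + b)] entering Sigma_(k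
   + b) - Sigma_k are far apart, so psi-mixing bounds the joint law of the
   blocks by a constant times the product of their laws, i.e. times the law of
   the corresponding sum S_b over independent copies. The exponential moments
   give P(S_b >= x b) <= exp (- rho b) with rho > I(beta) when x > beta
   (Chernoff), and P(S_b >= y b) >= exp (- rho b) with rho < I(beta) when y <
   beta (tilting at a point where Pi' lies between y and beta).

   Upper bound: there are about exp (I(beta) b) windows, and a window with a
   small start is cut into shorter pieces, which start late relative to their
   own length. Lower bound: among about exp (I(beta) b) / b windows taken with
   large gaps from a range on which the multiples j k and j' k' never collide,
   all blocks (j, k) are mutually far apart, so the probability that every sum
   stays below y b is at most a constant times (1 - exp (- rho b) / 2) ^ (exp
   (I(beta) b) / b).

   Both probabilities are exponentially small in b, and b = b_c(n) determines
   n up to a bounded factor, so Borel-Cantelli over b is enough. *)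
Require Import Defs.
From HB Require Import structures.
From mathcomp Require Import all_boot all_order all_algebra.
From mathcomp Require Import all_classical all_reals all_analysis.
From mathcomp Require Import measurable_realfun.
From mathcomp Require Import zify ring lra.

Import Order.TTheory GRing.Theory Num.Theory.
Import numFieldNormedType.Exports.

Set Implicit Arguments.
Unset Strict Implicit.
Unset Printing Implicit Defensive.

Local Open Scope classical_set_scope.
Local Open Scope ring_scope.

(** * Domination on product spaces *)

(** Psi-mixing compares one past event with one future event, that is, it speaks of rectangles, and
    an event about a block sum is not a rectangle. Hence [quasi_indep]: the joint law of two
    variables is dominated by [C] times the product of the marginals, first on rectangles, then on
    all measurable sets. Being multiplicative, this can be iterated. Only upper bounds are
    transferred: the lower deviation estimate enters through the event that all sums stay small.

    The [l N] blocks are ordered by multiplier: all blocks of one multiplier lie before all those of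
    the next. Separating the multipliers leads to [l] independent copies of the probability space;
    inside this product the windows are then separated one by one. The cost is [(1 + c) ^ (l + l N)]
    with [c] a bound on [psi(g)]: for one window the gap [g = 0] will do, for many [g] is a multiple
    of [b] that keeps the cost bounded.

    Mixing needs variables measurable on finite windows. So [X] is replaced by such a [Z] off small
    events before the comparison and put back afterwards, on the product space, where its block sums
    have a known law. *)

Section dominated_product.
Local Open Scope ereal_scope.
Context d1 d2 (T1 : measurableType d1) (T2 : measurableType d2) (R : realType).

(* These sets form a ring containing the rectangles, and an inequality between *)
(* measures passes from rectangles to them by countable additivity; the       *)
(* monotone class theorem does the rest.                                      *)
Definition sectionwise (E : set (T1 * T2)) :=
  exists (phi : T1 -> nat) (B : nat -> set T2),
    [/\ forall n, measurable (phi @^-1` [set n]), forall n, measurable (B n) &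
        E = [set z | B (phi z.1) z.2]].

(** Pairing the two partitions gives a common refinement, on each piece of which both sets have
    constant sections; [pickle] turns the pair of labels into one. *)
Lemma sectionwise_op (op : set T2 -> set T2 -> set T2)
    (op' : Prop -> Prop -> Prop) (E F : set (T1 * T2)) :
  (forall A B x, op A B x = op' (A x) (B x)) ->
  (forall A B, measurable A -> measurable B -> measurable (op A B)) ->
  sectionwise E -> sectionwise F ->
  sectionwise [set z | op' (E z) (F z)].
Proof.
move=> opE mop [f [A [mf mA ->]]] [g [B [mg mB ->]]].
exists (fun x => pickle (f x, g x)).
exists (fun n => if unpickle n is Some p then op (A p.1) (B p.2) else set0).
split=> [n|n|].
- have [[[i j] <-]|nE] := pselect (exists p : nat * nat, pickle p = n).
    rewrite (_ : _ @^-1` _ = f @^-1` [set i] `&` g @^-1` [set j]).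
      exact: measurableI.
    apply/seteqP; split=> x /=; last by move=> [-> ->].
    by move=> /(pcan_inj pickleK)[].
  rewrite (_ : _ @^-1` _ = set0)//; apply/seteqP; split=> x //= e.
  by apply: nE; eexists; exact: e.
- by case: (unpickle n : option (nat * nat)%type) => [p|//]; exact: mop.
- by apply/seteqP; split=> z /=; rewrite pickleK/= opE.
Qed.

Lemma setring_sectionwise : setring sectionwise.
Proof.
split.
- exists (fun=> 0%N), (fun=> set0); split=> [n||]//.
    by rewrite preimage_cst; case: ifP.
- move=> E F sE sF.
  apply: (@sectionwise_op (fun A B => A `|` B) or _ _ _ _ sE sF) => // A B.
  exact: measurableU.
- move=> E F sE sF.
  apply: (@sectionwise_op (fun A B => A `\` B) (fun P Q => P /\ ~ Q)
    _ _ _ _ sE sF) => // A B.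
  exact: measurableD.
Qed.

Lemma measurable_sectionwise (E : set (T1 * T2)) :
  sectionwise E -> measurable E.
Proof.
move=> [f [B [mf mB ->]]].
rewrite (_ : [set _ | _] = \bigcup_n (f @^-1` [set n] `*` B n)).
  by apply: bigcup_measurable => n _; exact: measurableX.
apply/seteqP; split=> [[x y] /= Bxy|[x y] [n _ [/= <-]]//].
by exists (f x).
Qed.

(** A rectangle is cut by the indicator of its first side, and the whole space is a rectangle, so
    that the generated sigma-ring is a sigma-algebra. *)
Lemma measurable_sub_g_sectionwise :
  @measurable _ (T1 * T2)%type `<=` <<sr sectionwise >>.
Proof.
have [sr0 srD srU] := smallest_sigma_ring sectionwise.
have srX A B : measurable A -> measurable B -> <<sr sectionwise >> (A `*` B).
  move=> mA mB; apply: sub_g_sigma_ring.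
  exists (fun x => (x \in A : nat)), (fun n => if n is 1%N then B else set0).
  split=> [n|[|[|n]]//|].
    case: n => [|[|n]].
    - rewrite (_ : _ @^-1` _ = ~` A); first exact: measurableC.
      apply/seteqP; split=> x /=; last by move=> nA; rewrite (memNset nA).
      by case: (boolP (x \in A)) => // /negP nA _ Ax; apply: nA; rewrite inE.
    - rewrite (_ : _ @^-1` _ = A)//.
      apply/seteqP; split=> x /=; last by move=> xA; rewrite (mem_set xA).
      by case: (boolP (x \in A)) => //; rewrite inE.
    - rewrite (_ : _ @^-1` _ = set0)//.
      by apply/seteqP; split=> x //=; case: (x \in A).
  apply/seteqP; split=> [[x y] [/= Ax By]|[x y] /=].
    by rewrite (mem_set Ax).
  by case: (boolP (x \in A)); rewrite // inE.
have srT : <<sr sectionwise >> setT.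
  by rewrite -setXTT; apply: srX.
rewrite measurable_prod_measurableType; apply: smallest_sub.
  split=> // A sA; exact: srD.
by move=> _ [A mA [B mB <-]]; exact: srX.
Qed.

Lemma dominated_product
    (mu nu : {measure set (T1 * T2)%type -> \bar R}) :
  mu setT < +oo -> nu setT < +oo ->
  (forall A B, measurable A -> measurable B ->
     mu (A `*` B) <= nu (A `*` B)) ->
  forall E, measurable E -> mu E <= nu E.
Proof.
move=> muoo nuoo mn E mE.
suff : <<sr sectionwise >> `<=` [set A | measurable A /\ mu A <= nu A].
  by move=> /(_ E (measurable_sub_g_sectionwise mE))[].
have fin (m : {measure set (T1 * T2)%type -> \bar R}) (A : set (T1 * T2)) :
    m setT < +oo -> measurable A -> m A < +oo.
  by move=> moo mA; apply: le_lt_trans moo; apply: le_measure; rewrite ?inE.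
apply: monotone_setring_sub_g_sigma_ring.
- split=> F mF FG.
    have mFn n : measurable (F n) by case: (FG n).
    have mU : measurable (\bigcup_i F i) by exact: bigcup_measurable.
    split=> //.
    have c1 := nondecreasing_cvg_mu (mu := mu) mFn mU mF.
    have c2 := nondecreasing_cvg_mu (mu := nu) mFn mU mF.
    apply: (lee_cvg_to c1 c2); apply: nearW => n; exact: (FG n).2.
  have mFn n : measurable (F n) by case: (FG n).
  have mU : measurable (\bigcap_i F i) by exact: bigcap_measurableType.
  split=> //.
  have c1 := nonincreasing_cvg_mu (mu := mu) (fin _ _ muoo (mFn 0%N)) mFn mU mF.
  have c2 := nonincreasing_cvg_mu (mu := nu) (fin _ _ nuoo (mFn 0%N)) mFn mU mF.
  apply: (lee_cvg_to c1 c2); apply: nearW => n; exact: (FG n).2.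
- exact: setring_sectionwise.
- move=> A sA; split; first exact: measurable_sectionwise.
  case: sA => f [B [mf mB ->]].
  pose F n := f @^-1` [set n] `*` B n.
  have -> : [set z | B (f z.1) z.2] = \bigcup_n F n.
    apply/seteqP; split=> [[x y] /= Bxy|[x y] [n _ [/= <-]]//].
    by exists (f x).
  have mF n : measurable (F n) by exact: measurableX.
  have tF : trivIset setT F.
    by apply/trivIsetP => i j _ _ ij; apply/seteqP; split=> [[x y]|//] [[/= fi _] [/= fj _]]; move: ij; rewrite -fi -fj eqxx.
  rewrite !measure_bigcup//; apply: lee_nneseries => // n _.
  exact: mn.
Qed.

End dominated_product.

Section two_blocks.
Local Open Scope ereal_scope.
Context d (Om : measurableType d) (R : realType) (P : probability Om R).

Definition mfun_of d1 d2 (T1 : measurableType d1) (T2 : measurableType d2)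
    (f : T1 -> T2) (mf : measurable_fun setT f) : {mfun T1 >-> T2} :=
  HB.pack f (isMeasurableFun.Build _ _ _ _ _ mf).

Definition quasi_indep d1 d2 (S1 : measurableType d1) (S2 : measurableType d2)
    (C : R) (f : Om -> S1) (g : Om -> S2) :=
  forall A B, measurable A -> measurable B ->
    P (f @^-1` A `&` g @^-1` B) <= C%:E * P (f @^-1` A) * P (g @^-1` B).

Context d1 d2 (S1 : measurableType d1) (S2 : measurableType d2).
Variables (C : R) (f : Om -> S1) (g : Om -> S2).
Hypotheses (C0 : (0 <= C)%R) (mf : measurable_fun setT f)
  (mg : measurable_fun setT g) (fg : quasi_indep C f g).

Let joint := distribution P (mfun_of (measurable_fun_pair mf mg)).
Let indep := mscale (NngNum C0)
  (distribution P (mfun_of mf) \x distribution P (mfun_of mg)).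

Lemma joint_dominated E : measurable E -> joint E <= indep E.
Proof.
have indepT : indep [set: S1 * S2] < +oo.
  have /= := probability_setT
    (distribution P (mfun_of mf) \x distribution P (mfun_of mg)).
  by rewrite /indep /mscale/= => ->; rewrite mule1 ltry.
apply: dominated_product => //.
- by have /= -> := probability_setT joint; rewrite ltry.
- move=> A B mA mB.
  suff H : joint (A `*` B) <= C%:E * (distribution P (mfun_of mf) \x
    distribution P (mfun_of mg)) (A `*` B) by exact: H.
  by rewrite product_measure1E// muleA; exact: fg.
Qed.

(** Under the dominating product law [f] and [g] are read at two independent sample points, here [x]
    and [w]. *)
Lemma quasi_indep_set (E : set (S1 * S2)) : measurable E ->
  P [set w | E (f w, g w)] <= C%:E * \int[P]_x P [set w | E (f x, g w)].
Proof.
move=> mE; apply: (le_trans (joint_dominated mE)).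
change (C%:E * (distribution P (mfun_of mf) \x distribution P (mfun_of mg)) E <=
  C%:E * \int[P]_x P [set w | E (f x, g w)]).
rewrite /product_measure1.
have msec : measurable_fun setT (distribution P (mfun_of mg) \o xsection E).
  exact: measurable_fun_xsection.
have secE x : (distribution P (mfun_of mg) \o xsection E) (f x) =
    P [set w | E (f x, g w)].
  rewrite /= /distribution /pushforward/=; congr (P _).
  by apply/seteqP; split=> w /=; rewrite /xsection/= inE.
rewrite ge0_integral_distribution//.
rewrite (eq_integral (fun x => P [set w | E (f x, g w)]))// => x _.
exact: secE.
Qed.

(** The version for functions is needed when coordinates are peeled off: the probabilities of the
    sections then take the place of events. *)
Lemma quasi_indep_integral (u : S1 -> \bar R) (v : S2 -> \bar R) :
  measurable_fun setT u -> measurable_fun setT v ->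
  (forall x, 0 <= u x) -> (forall x, 0 <= v x) ->
  \int[P]_w (u (f w) * v (g w)) <=
  C%:E * (\int[P]_w u (f w)) * (\int[P]_w v (g w)).
Proof.
move=> mu mv u0 v0.
pose h (z : S1 * S2) := u z.1 * v z.2.
have mh : measurable_fun setT h.
  by apply: emeasurable_funM; apply: measurableT_comp.
have h0 z : 0 <= h z by rewrite mule_ge0.
rewrite [leLHS](_ : _ = \int[joint]_z h z); last first.
  by rewrite ge0_integral_distribution.
apply: (le_trans (ge0_le_measure_integral joint_dominated _ _ _)) => //.
rewrite ge0_integral_mscale//= -muleA; apply: lee_wpmul2l; first by rewrite lee_fin.
rewrite fubini_tonelli1//= ge0_integral_distribution//; last 2 first.
- exact: measurable_fun_fubini_tonelli_F.
- by move=> x; apply: integral_ge0.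
rewrite -ge0_integralZr//; last 2 first.
- exact: (measurableT_comp mu mf).
- by apply: integral_ge0 => x _; exact: v0.
rewrite le_eqVlt; apply/orP; left; apply/eqP/eq_integral => x _ /=.
rewrite /fubini_F/= /h/= ge0_integralZl//.
by rewrite ge0_integral_distribution.
Qed.

End two_blocks.

(** * Products of a probability over tuples *)

Lemma measurable_preimage d1 d2 (T1 : measurableType d1)
    (T2 : measurableType d2) (f : T1 -> T2) (A : set T2) :
  measurable_fun setT f -> measurable A -> measurable (f @^-1` A).
Proof. by move=> mf mA; rewrite -[_ @^-1` _]setTI; exact: mf. Qed.

Section tuple_product.
Local Open Scope ereal_scope.
Context d (Om : measurableType d) (R : realType) (P : probability Om R).

Definition cons_mfun r : {mfun (Om * r.-tuple Om)%type >-> r.+1.-tuple Om} :=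
  mfun_of (measurable_cons (@measurable_fst _ _ Om (r.-tuple Om))
    (@measurable_snd _ _ Om (r.-tuple Om))).

(** Copies of [Om] itself carry the independent blocks: below, [coordwise] reads each function at
    its own coordinate, which makes them independent, while [joint] reads all of them at one sample
    point. *)
Fixpoint tuple_prob r : probability (r.-tuple Om) R :=
  match r with
  | 0 => \d_([tuple])
  | r'.+1 => distribution (P \x tuple_prob r') (cons_mfun r')
  end.

Lemma tuple_probS r (E : set (r.+1.-tuple Om)) :
  tuple_prob r.+1 E = \int[P]_x tuple_prob r [set t | E (cons_tuple x t)].
Proof.
rewrite /= /distribution /pushforward /product_measure1.
apply: eq_integral => x _ /=; congr (tuple_prob r _).
by apply/seteqP; split=> t /=; rewrite /xsection/= inE.
Qed.

Context dS (S : measurableType dS).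
Implicit Types f g : nat -> Om -> S.

Definition coordwise f r (t : r.-tuple Om) : r.-tuple S :=
  [tuple f i (tnth t i) | i < r].

Definition joint f r (w : Om) : r.-tuple S := [tuple f i w | i < r].

Lemma coordwise_cons f r x (t : r.-tuple Om) :
  coordwise f (cons_tuple x t) =
  cons_tuple (f 0%N x) (coordwise (fun i => f i.+1) t).
Proof.
apply: eq_from_tnth => i; rewrite tnth_mktuple.
have [j ->|->] := unliftP ord0 i; last by rewrite !tnth0.
by rewrite !tnthS tnth_mktuple.
Qed.

Lemma joint_cons f r x :
  joint f r.+1 x = cons_tuple (f 0%N x) (joint (fun i => f i.+1) r x).
Proof.
apply: eq_from_tnth => i; rewrite tnth_mktuple.
have [j ->|->] := unliftP ord0 i; last by rewrite !tnth0.
by rewrite !tnthS tnth_mktuple.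
Qed.

Lemma measurable_coordwise f r :
  (forall i, measurable_fun setT (f i)) ->
  measurable_fun setT (@coordwise f r).
Proof.
move=> mf; apply/measurable_fun_tnthP => i.
rewrite (_ : _ \o _ = f i \o (@tnth _ Om ^~ i)).
  by apply: measurableT_comp => //; exact: measurable_tnth.
by apply/funext => t /=; rewrite tnth_mktuple.
Qed.

Lemma measurable_joint f r :
  (forall i, measurable_fun setT (f i)) -> measurable_fun setT (joint f r).
Proof.
move=> mf; apply/measurable_fun_tnthP => i.
rewrite (_ : _ \o _ = f i)//.
by apply/funext => t /=; rewrite tnth_mktuple.
Qed.

Definition csection r (E : set (r.+1.-tuple S)) (s : S) : set (r.-tuple S) :=
  [set y | E (cons_tuple s y)].

Lemma measurable_csection r (E : set (r.+1.-tuple S)) s :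
  measurable E -> measurable (csection E s).
Proof.
move=> mE; rewrite -[csection E s]setTI.
have := measurable_cons (@measurable_cst _ _ (r.-tuple S) _ setT s)
  (@measurable_id _ (r.-tuple S) setT).
by apply.
Qed.

Lemma measurable_prob_csection d2 (T : measurableType d2)
    (m : probability T R) r (E : set (r.+1.-tuple S)) (g : T -> r.-tuple S) :
  measurable_fun setT g -> measurable E ->
  measurable_fun setT (fun s => m (g @^-1` csection E s)).
Proof.
move=> mg mE.
pose E' : set (S * T) := [set z | E (cons_tuple z.1 (g z.2))].
have mE' : measurable E'.
  rewrite -[E']setTI; have := measurable_cons (@measurable_fst _ _ S T)
    (measurableT_comp mg (@measurable_snd _ _ S T)).
  by apply.
rewrite (_ : (fun s => _) = m \o xsection E').
  exact: measurable_fun_xsection.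
apply/funext => s /=; congr (m _).
by apply/seteqP; split=> t /=; rewrite /xsection/= inE.
Qed.

Lemma tuple_prob_coordwiseS f r (E : set (r.+1.-tuple S)) :
  tuple_prob r.+1 (@coordwise f r.+1 @^-1` E) =
  \int[P]_x tuple_prob r
    (@coordwise (fun i => f i.+1) r @^-1` csection E (f 0%N x)).
Proof.
rewrite tuple_probS; apply: eq_integral => x _; congr (tuple_prob r _).
by apply/seteqP; split=> t /=; rewrite /csection/= coordwise_cons.
Qed.

(* The blocks are peeled off from the left: the first one is compared with the *)
(* joint law of all the later ones.                                           *)
Lemma joint_le_tuple_prob (C : R) f r : (0 <= C)%R ->
  (forall i, measurable_fun setT (f i)) ->
  (forall i n, (i + n.+1 = r)%N ->
     quasi_indep P C (f i) (joint (fun j => f (i.+1 + j)%N) n)) ->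
  forall E, measurable E ->
    P (joint f r @^-1` E) <= (C ^+ r)%:E * tuple_prob r (@coordwise f r @^-1` E).
Proof.
move=> C0; elim: r f => [|r IH] f mf fq E mE.
  rewrite expr0 mul1e /= diracE.
  have [E0|E0] := pselect (E [tuple]).
    rewrite mem_set//=; last by rewrite tuple0.
    by apply: probability_le1; apply: (measurable_preimage _ mE);
      exact: measurable_joint.
  rewrite (_ : _ @^-1` _ = set0) ?measure0//.
  by apply/seteqP; split=> // w /=; rewrite tuple0.
have mu : measurable_fun setT (fun s => tuple_prob r
    (@coordwise (fun i => f i.+1) r @^-1` csection E s)).
  by apply: measurable_prob_csection => //; exact: measurable_coordwise.
have mj : measurable_fun setT (joint (fun i => f i.+1) r).
  exact: measurable_joint.
pose E' : set (S * r.-tuple S) := [set z | E (cons_tuple z.1 z.2)].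
have mE' : measurable E'.
  rewrite -[E']setTI; have := measurable_cons (@measurable_fst _ _ S (r.-tuple S))
    (@measurable_snd _ _ S (r.-tuple S)).
  by apply.
rewrite (_ : _ @^-1` _ = [set w | E' (f 0%N w, joint (fun i => f i.+1) r w)]);
  last by apply/seteqP; split=> w /=; rewrite joint_cons.
have q0 : quasi_indep P C (f 0%N) (joint (fun i => f i.+1) r) by exact: fq.
apply: (le_trans (quasi_indep_set C0 (mf 0%N) mj q0 mE')).
rewrite exprS EFinM -muleA; apply: lee_wpmul2l; first by rewrite lee_fin.
rewrite tuple_prob_coordwiseS -ge0_integralZl//; last 2 first.
- exact: (measurableT_comp mu (mf 0%N)).
- by rewrite lee_fin exprn_ge0.
apply: ge0_le_integral => //.
- apply: (measurableT_comp (measurable_prob_csection P mj mE) (mf 0%N)).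
- by apply: emeasurable_funM => //; exact: (measurableT_comp mu (mf 0%N)).
- move=> x _; apply: IH => //.
    by move=> i n rE; apply: (fq i.+1); rewrite addSn rE.
  exact: measurable_csection.
Qed.

End tuple_product.

Section tuple_product2.
Local Open Scope ereal_scope.
Context d (Om : measurableType d) (R : realType) (P : probability Om R).
Context d1 (S1 : measurableType d1) d2 (S2 : measurableType d2).

(** Domination tensorizes: once the first coordinate is fixed, the induction hypothesis bounds the
    probability of the section by a function of [f 0] times a function of [g 0], and the bound for
    integrals applies to these. *)
Lemma quasi_indep_coordwise (C : R) (f : nat -> Om -> S1)
    (g : nat -> Om -> S2) r : (0 <= C)%R ->
  (forall i, measurable_fun setT (f i)) ->
  (forall i, measurable_fun setT (g i)) ->
  (forall i, quasi_indep P C (f i) (g i)) ->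
  quasi_indep (tuple_prob P r) (C ^+ r) (@coordwise _ _ _ _ f r)
    (@coordwise _ _ _ _ g r).
Proof.
move=> C0; elim: r f g => [|r IH] f g mf mg fg A B mA mB.
  rewrite expr0 mul1e /= !diracE; rewrite in_setI.
  rewrite -EFinM lee_fin -natrM ler_nat.
  by case: ([tuple] \in _ @^-1` A); case: ([tuple] \in _ @^-1` B).
rewrite !tuple_prob_coordwiseS.
pose f' i := f i.+1; pose g' i := g i.+1.
have mcf : measurable_fun setT (@coordwise _ _ _ _ f' r).
  by apply: measurable_coordwise => i; exact: mf.
have mcg : measurable_fun setT (@coordwise _ _ _ _ g' r).
  by apply: measurable_coordwise => i; exact: mg.
pose u s := tuple_prob P r (@coordwise _ _ _ _ f' r @^-1` csection A s).
pose v s := tuple_prob P r (@coordwise _ _ _ _ g' r @^-1` csection B s).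
have mu : measurable_fun setT u by exact: measurable_prob_csection.
have mv : measurable_fun setT v by exact: measurable_prob_csection.
rewrite exprSr EFinM -!muleA.
apply: (@le_trans _ _ ((C ^+ r)%:E * \int[P]_w (u (f 0%N w) * v (g 0%N w)))).
  have muv : measurable_fun setT (fun w => u (f 0%N w) * v (g 0%N w)).
    apply: emeasurable_funM; first exact: (measurableT_comp mu (mf 0%N)).
    exact: (measurableT_comp mv (mg 0%N)).
  rewrite -ge0_integralZl//; last 2 first.
  - by move=> x _; rewrite mule_ge0.
  - by rewrite lee_fin exprn_ge0.
  rewrite tuple_probS; apply: ge0_le_integral => //.
  - have mI : measurable (@coordwise _ _ _ _ f r.+1 @^-1` A `&`
        @coordwise _ _ _ _ g r.+1 @^-1` B).
      by apply: measurableI; apply: measurable_preimage => //;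
        apply: measurable_coordwise.
    exact: (measurable_prob_csection (tuple_prob P r)
      (@measurable_id _ _ setT) mI).
  - exact: emeasurable_funM.
  - move=> x _; have := IH f' g' (fun i => mf i.+1) (fun i => mg i.+1)
      (fun i => fg i.+1) _ _ (measurable_csection (f 0%N x) mA)
        (measurable_csection (g 0%N x) mB).
    rewrite -muleA; apply: le_trans; rewrite le_eqVlt; apply/orP; left.
    apply/eqP; congr (tuple_prob P r _).
    by apply/seteqP; split=> t /=; rewrite /csection/= !coordwise_cons.
apply: lee_wpmul2l; first by rewrite lee_fin exprn_ge0.
by rewrite muleA; exact: quasi_indep_integral.
Qed.

Lemma tuple_prob_rectangle (A : nat -> set Om) r :
  (forall i, measurable (A i)) ->
  tuple_prob P r [set t | forall i : 'I_r, A i (tnth t i)] =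
  \prod_(i < r) P (A i).
Proof.
elim: r A => [|r IH] A mA.
  rewrite big_ord0 (_ : [set _ | _] = setT) ?probability_setT//.
  by apply/seteqP; split=> // t _ [].
rewrite tuple_probS big_ord_recl.
rewrite -(IH (fun i => A i.+1))//.
have -> : P (A (ord0 : 'I_r.+1)) = \int[P]_x (\1_(A 0%N) x)%:E.
  by rewrite integral_indic// setIT.
rewrite -ge0_integralZr//; last by apply/measurable_EFinP.
apply: eq_integral => x _; rewrite indicE.
have [Ax|nAx] := pselect (A 0%N x).
  rewrite mem_set// mul1e; congr (tuple_prob P r _).
  apply/seteqP; split=> t /= H i.
    by have := H (lift ord0 i); rewrite tnthS.
  have [j ->|->] := unliftP ord0 i; last by rewrite tnth0.
  by rewrite tnthS; exact: H.
rewrite memNset// mul0e (_ : [set _ | _] = set0) ?measure0//.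
by apply/seteqP; split=> // t /= /(_ ord0); rewrite tnth0.
Qed.

End tuple_product2.

(** * Real-valued probabilities and union bounds *)

Section real_probability.
Context d (Om : measurableType d) (R : realType) (P : probability Om R).
Implicit Types A B : set Om.

Definition pr A : R := fine (P A).

Lemma prE A : measurable A -> P A = (pr A)%:E.
Proof. by move=> mA; rewrite fineK// fin_num_measure. Qed.

Lemma pr_ge0 A : 0 <= pr A.
Proof. exact: fine_ge0. Qed.

Lemma pr_le1 A : measurable A -> pr A <= 1.
Proof. by move=> mA; rewrite -lee_fin -prE// probability_le1. Qed.

Lemma prC A : measurable A -> pr (~` A) = 1 - pr A.
Proof.
move=> mA; rewrite /pr (_ : P (~` A) = 1 - P A)%E; last exact: probability_setC.
by rewrite prE.
Qed.

Lemma le_pr A B : measurable A -> measurable B -> A `<=` B -> pr A <= pr B.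
Proof.
by move=> mA mB AB; rewrite -lee_fin -!prE//; apply: le_measure; rewrite ?inE.
Qed.

Lemma pr_bigcup n (A : nat -> set Om) B :
  (forall i, (i < n)%N -> measurable (A i)) -> measurable B ->
  (forall w, B w -> exists2 i, (i < n)%N & A i w) ->
  pr B <= \sum_(i < n) pr (A i).
Proof.
move=> mA mB BA; rewrite -lee_fin -prE// -sumEFin.
have mU : measurable (\big[setU/set0]_(i < n) A i).
  by apply: bigsetU_measurable => i _; exact: mA.
apply: (@le_trans _ _ (P (\big[setU/set0]_(i < n) A i))).
  apply: le_measure; rewrite ?inE// => w /BA[i ilt Aw].
  by rewrite -bigcup_mkord; exists i.
apply: (le_trans (Boole_inequality P mA)).
by apply: lee_sum => i _; rewrite /pr fineK// fin_num_measure//; exact: mA.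
Qed.

Lemma pr_setU A B C : measurable A -> measurable B -> measurable C ->
  C `<=` A `|` B -> pr C <= pr A + pr B.
Proof.
move=> mA mB mC CAB.
have := @pr_bigcup 2 (fun i => if i is 0%N then A else B) C.
rewrite !big_ord_recl big_ord0/= addr0; apply=> //; first by case.
by move=> w /CAB[Aw|Bw]; [exists 0%N|exists 1%N].
Qed.

End real_probability.

(** * The product space as a model of independent variables *)

Section independent_coordinates.
Context d (Om : measurableType d) (R : realType) (P : probability Om R).
Context d' (Om' : measurableType d') (Q : probability Om' R).
Context dS (S : measurableType dS) (r : nat).

Lemma tuple_prob_rectangle_ord (A : 'I_r -> set Om) :
  (forall i, measurable (A i)) ->
  tuple_prob P r [set t | forall i, A i (tnth t i)] = (\prod_(i < r) P (A i))%E.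
Proof.
move=> mA; pose A' i := if insub i is Some j then A j else setT.
have A'E (i : 'I_r) : A' i = A i by rewrite /A' valK.
under eq_bigr do rewrite -A'E.
rewrite -tuple_prob_rectangle; last first.
  by move=> i; rewrite /A'; case: insub.
by congr (tuple_prob P r _); apply/seteqP; split=> t /= H i; have := H i; rewrite A'E.
Qed.

Lemma tuple_prob_marginal (i : 'I_r) (A : set Om) : measurable A ->
  tuple_prob P r [set t | A (tnth t i)] = P A.
Proof.
move=> mA; pose A' j := if j == i then A else setT.
rewrite (_ : [set _ | _] = [set t | forall j, A' j (tnth t j)]).
  rewrite tuple_prob_rectangle_ord; last by move=> j; rewrite /A'; case: ifP.
  rewrite (bigD1 i)//= /A' eqxx big1 ?mule1// => j /negbTE ->.
  exact: probability_setT.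
apply/seteqP; split=> t /=; last by move=> /(_ i); rewrite /A' eqxx.
by move=> At j; rewrite /A'; case: eqP => [->|].
Qed.

Definition rectangles : set (set (r.-tuple S)) :=
  [set B | exists2 A : 'I_r -> set S, forall i, measurable (A i) &
     B = [set t | forall i, A i (tnth t i)]].

Lemma measurable_rectangles : @measurable _ (r.-tuple S) = <<s rectangles >>.
Proof.
apply/seteqP; split.
  apply: smallest_sub; first exact: smallest_sigma_algebra.
  move=> B; rewrite -bigcup_seq => -[i _ [A mA <-]].
  apply: sub_sigma_algebra; exists (fun j => if j == i then A else setT).
    by move=> j; case: ifP.
  rewrite setTI; apply/seteqP; split=> t /=; last by move=> /(_ i); rewrite eqxx.
  by move=> At j; case: eqP => [->|].
apply: smallest_sub; first exact: sigma_algebra_measurable.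
move=> _ [A mA ->].
rewrite (_ : [set _ | _] = \bigcap_(i in [set: 'I_r]) ((@tnth r S)^~ i @^-1` A i)).
  apply: fin_bigcap_measurable => // i _; apply: measurable_preimage => //.
  exact: measurable_tnth.
by apply/seteqP; split=> t /= H i; [move=> _; exact: H|exact: (H i I)].
Qed.

(** Both sides are laws on tuples that agree on rectangles, a generating family stable under
    intersection. *)
Lemma tuple_prob_joint (f : nat -> Om -> S) (Y : 'I_r -> Om' -> S) :
  (forall i, measurable_fun setT (f i)) ->
  (forall i, measurable_fun setT (Y i)) ->
  (forall (i : 'I_r) A, measurable A -> P (f i @^-1` A) = Q (Y i @^-1` A)) ->
  (forall A : 'I_r -> set S, (forall i, measurable (A i)) ->
     Q (\bigcap_i (Y i @^-1` A i)) = (\prod_(i < r) Q (Y i @^-1` A i))%E) ->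
  forall E, measurable E ->
    tuple_prob P r (@coordwise _ _ _ _ f r @^-1` E) =
    Q [set w | E [tuple Y i w | i < r]].
Proof.
move=> mf mY fY iY E mE.
have mYj : measurable_fun setT (fun w => [tuple Y i w | i < r]).
  apply/measurable_fun_tnthP => i; rewrite (_ : _ \o _ = Y i)//.
  by apply/funext => w /=; rewrite tnth_mktuple.
pose m1 := distribution (tuple_prob P r) (mfun_of (measurable_coordwise (r := r) mf)).
pose m2 := distribution Q (mfun_of mYj).
suff : m1 E = m2 E by [].
apply: (measure_unique rectangles (fun=> setT)) => //.
- exact: measurable_rectangles.
- move=> _ _ [A mA ->] [B mB ->]; exists (fun i => A i `&` B i).
    by move=> i; exact: measurableI.
  apply/seteqP; split=> t /=; first by move=> [tA tB] i; split.
  by move=> H; split=> i; have [] := H i.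
- move=> _; exists (fun=> setT) => //.
  by apply/seteqP; split.
- by apply/seteqP; split=> // t _; exists 0%N.
- move=> _ [A mA ->].
  transitivity (tuple_prob P r
      [set t | forall i : 'I_r, (f i @^-1` A i) (tnth t i)]).
    apply: (congr1 (tuple_prob P r)).
    by apply/seteqP; split=> t /= H i; have := H i; rewrite tnth_mktuple.
  rewrite (@tuple_prob_rectangle_ord (fun i : 'I_r => f i @^-1` A i)); last first.
    by move=> i; apply: measurable_preimage.
  under eq_bigr => i _ do rewrite fY//.
  rewrite -iY//; apply: (congr1 Q); apply/seteqP; split=> w /=.
    by move=> H i; rewrite tnth_mktuple; exact: H.
  by move=> H i _ /=; have := H i; rewrite tnth_mktuple.
- by move=> _; rewrite -ge0_fin_numE// fin_num_measure.
Qed.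

End independent_coordinates.

(** * Mixing and separated blocks *)

Section sub_measurable_functions.
Context d (Om : measurableType d) dT (T : measurableType dT).
Implicit Types (G H : set (set Om)) (f : Om -> T).

Lemma sub_measurable_preimage G f A :
  sub_measurable G f -> measurable A -> G (f @^-1` A).
Proof. by move=> Gf mA; apply: Gf; exists A => //; rewrite setTI. Qed.

Lemma sub_measurable_fun G f :
  G `<=` measurable -> sub_measurable G f -> measurable_fun setT f.
Proof.
by move=> Gm Gf _ A mA; rewrite setTI; apply: Gm; exact: sub_measurable_preimage.
Qed.

Lemma sub_measurableS G H f : G `<=` H -> sub_measurable G f -> sub_measurable H f.
Proof. by move=> GH Gf A /Gf /GH. Qed.

Lemma sub_measurable_tuple G n (f : Om -> n.-tuple T) : sigma_algebra setT G ->
  (forall i, sub_measurable G (fun w => tnth (f w) i)) -> sub_measurable G f.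
Proof.
move=> [G0 GC GU] Gf _ [B mB <-]; rewrite setTI.
have : g_sigma_preimage (fun i : 'I_n => @tnth n T ^~ i)
    `<=` [set B | G (f @^-1` B)].
  apply: smallest_sub.
    split=> /=; first by rewrite preimage_set0.
      by move=> A GA; rewrite setTD preimage_setC -setTD; exact: GC.
    by move=> A GA; rewrite preimage_bigcup; exact: GU.
  move=> A; rewrite -bigcup_seq => -[i _ [D mD <-]] /=.
  by rewrite setTI; exact: (sub_measurable_preimage (Gf i) mD).
exact.
Qed.

Lemma sub_measurable_joint G n (f : nat -> Om -> T) : sigma_algebra setT G ->
  (forall i, (i < n)%N -> sub_measurable G (f i)) -> sub_measurable G (joint f n).
Proof.
move=> sG Gf; apply: sub_measurable_tuple => // i.
rewrite (_ : (fun w => _) = f i); first exact: Gf.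
by apply/funext => w; rewrite tnth_mktuple.
Qed.

End sub_measurable_functions.

Section mixing_quasi_indep.
Context d (Om : measurableType d) (R : realType) (P : probability Om R).
Variable Fm : \bar int -> \bar int -> set (set Om).
Hypothesis hFm : monotone_sigma_algebras Fm.
Context d1 (S1 : measurableType d1) d2 (S2 : measurableType d2).

(** The supremum in [psi] runs only over pairs with [P A * P B <> 0]; in the other case [A] or [B]
    is null, and so is the intersection. *)
Lemma psi_quasi_indep (n k : nat) (c : R) (f : Om -> S1) (g : Om -> S2) :
  0 <= c -> (psi P Fm n <= c%:E)%E ->
  sub_measurable (Fm -oo%E k%:Z%:E) f ->
  sub_measurable (Fm (k + n)%N%:Z%:E +oo%E) g ->
  quasi_indep P (1 + c) f g.
Proof.
move=> c0 psic fk gkn A B mA mB.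
have [_ [Fmeas _]] := hFm.
have FA := sub_measurable_preimage fk mA.
have FB := sub_measurable_preimage gkn mB.
have mfA : measurable (f @^-1` A) by apply: Fmeas FA; rewrite leNye.
have mgB : measurable (g @^-1` B) by apply: Fmeas FB; rewrite leey.
move: FA FB mfA mgB; move: (f @^-1` A) (g @^-1` B) => {mA mB}A {}B FA FB mA mB.
have mAB : measurable (A `&` B) by exact: measurableI.
rewrite !prE// -!EFinM lee_fin.
have [PAB0|PAB0] := eqVneq (pr P A * pr P B) 0.
  rewrite -mulrA PAB0 mulr0.
  move/eqP: PAB0; rewrite mulf_eq0 => /orP[]/eqP <-.
    by apply: le_pr => //; exact: subIsetl.
  by apply: le_pr => //; exact: subIsetr.
have : (`|pr P (A `&` B) / (pr P A * pr P B) - 1|%:E <= psi P Fm n)%E.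
  apply: ereal_sup_ubound; exists k, A, B; split=> //.
  by rewrite !prE// -EFinM => -[/eqP]; rewrite (negbTE PAB0).
move=> /le_trans /(_ psic); rewrite lee_fin => /(le_trans (ler_norm _)).
rewrite lerBlDl ler_pdivrMr ?mulrA//.
by rewrite lt_neqAle eq_sym PAB0 mulr_ge0 ?pr_ge0.
Qed.

End mixing_quasi_indep.

Section slices.
Context d (Om : measurableType d) (R : realType) (P : probability Om R).
Context dS (S : measurableType dS) (r : nat).

(** Arrays have one row per multiplier, while events concern one window, or one time, across all
    multipliers: [slice] reads a column. *)
Definition slice N (x : r.-tuple (N.-tuple S)) (s : 'I_N) : r.-tuple S :=
  [tuple tnth (tnth x j) s | j < r].

Lemma measurable_slice N (s : 'I_N) :
  measurable_fun setT (fun x : r.-tuple (N.-tuple S) => slice x s).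
Proof.
apply/measurable_fun_tnthP => j.
rewrite (_ : _ \o _ = (@tnth N S)^~ s \o (@tnth r (N.-tuple S))^~ j).
  by apply: measurableT_comp; exact: measurable_tnth.
by apply/funext => x /=; rewrite tnth_mktuple.
Qed.

Lemma measurable_all_slices N (E : nat -> set (r.-tuple S)) :
  (forall s, measurable (E s)) ->
  measurable [set x : r.-tuple (N.-tuple S) | forall s : 'I_N, E s (slice x s)].
Proof.
move=> mE; rewrite (_ : [set _ | _] =
    \bigcap_(s in [set: 'I_N]) ((fun x => slice x s) @^-1` E s)).
  apply: fin_bigcap_measurable => // s _; apply: measurable_preimage => //.
  exact: measurable_slice.
by apply/seteqP; split=> x /= H s; [move=> _; exact: H|exact: (H s I)].
Qed.

Lemma slice_coordwise_joint N (zeta : nat -> nat -> Om -> S) t (s : 'I_N) :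
  slice (@coordwise _ _ _ _ (fun j => joint (fun i => zeta i j) N) r t) s =
  coordwise (zeta s) t.
Proof. by apply: eq_from_tnth => j; rewrite !tnth_mktuple. Qed.

Lemma slice_joint_joint N (zeta : nat -> nat -> Om -> S) w (s : 'I_N) :
  slice (joint (fun j => joint (fun i => zeta i j) N) r w) s =
  joint (zeta s) r w.
Proof. by apply: eq_from_tnth => j; rewrite !tnth_mktuple. Qed.

(** The window [s = 0] is compared with all later ones in the [r] coordinates at once, at the cost
    of a factor [C ^ r]; this is repeated for each of the [N] windows. *)
Lemma tuple_prob_slices (C : R) N (zeta : nat -> nat -> Om -> S)
    (E : nat -> set (r.-tuple S)) : 0 <= C ->
  (forall s j, measurable_fun setT (zeta s j)) ->
  (forall s, measurable (E s)) ->
  (forall s n j, quasi_indep P C (zeta s j)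
     (joint (fun i => zeta (s.+1 + i)%N j) n)) ->
  pr (tuple_prob P r)
    [set t | forall s : 'I_N, E s (coordwise (zeta s) t)] <=
  C ^+ (r * N) *
    \prod_(s < N) pr (tuple_prob P r) (@coordwise _ _ _ _ (zeta s) r @^-1` E s).
Proof.
move=> C0; elim: N zeta E => [|N IH] zeta E mz mE qz.
  rewrite muln0 expr0 big_ord0 mul1r.
  by apply: pr_le1; rewrite (_ : [set _ | _] = setT)//; apply/seteqP; split=> // t _ [].
pose g j := joint (fun i => zeta i.+1 j) N.
pose H := [set x : r.-tuple (N.-tuple S) | forall s : 'I_N, E s.+1 (slice x s)].
have mH : measurable H 
  by apply: (@measurable_all_slices N (fun s => E s.+1)) => s; exact: mE.
have mg j : measurable_fun setT (g j).
  by apply: measurable_joint => i; exact: mz.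
have mA : measurable (@coordwise _ _ _ _ (zeta 0%N) r @^-1` E 0%N).
  exact: (measurable_preimage (measurable_coordwise (mz 0%N)) (mE 0%N)).
have mB : measurable (@coordwise _ _ _ _ g r @^-1` H).
  exact: (measurable_preimage (measurable_coordwise mg) mH).
have := quasi_indep_coordwise (r := r) C0 (mz 0%N) mg (qz 0%N N) (mE 0%N) mH.
rewrite !prE//; last exact: measurableI.
rewrite -!EFinM lee_fin => h.
rewrite (_ : [set _ | _] =
    @coordwise _ _ _ _ (zeta 0%N) r @^-1` E 0%N `&` @coordwise _ _ _ _ g r @^-1` H);
    last first.
  apply/seteqP; split=> t /=.
    move=> Et; split; first exact: (Et ord0).
    by move=> s; rewrite slice_coordwise_joint; exact: (Et (lift ord0 s)).
  move=> [E0 Ht] s; have [j ->|->//] := unliftP ord0 s.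
  by have := Ht j; rewrite slice_coordwise_joint.
apply: (le_trans h); rewrite big_ord_recl mulnS exprD -!mulrA.
rewrite ler_wpM2l ?exprn_ge0// mulrCA ler_wpM2l ?pr_ge0//.
have := IH (fun s => zeta s.+1) (fun s => E s.+1) (fun s => mz s.+1)
  (fun s => mE s.+1) (fun s n j => qz s.+1 n j).
apply: le_trans; rewrite le_eqVlt; apply/orP; left; apply/eqP; congr (pr _ _).
by apply/seteqP; split=> t /= Ht s; have := Ht s; rewrite slice_coordwise_joint.
Qed.

End slices.

Section blocks.
Context d (Om : measurableType d) (R : realType) (P : probability Om R).
Variables (p l : nat) (F : l.-tuple (p.-tuple R) -> R).
Hypothesis mF : measurable_fun setT F.
Local Notation T := (p.-tuple R).
Implicit Types (Z : nat -> Om -> T) (Bad : nat -> set Om).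

(* The index j = 0, ..., l - 1 stands for the multiplier j + 1. *)
Definition block Z (b k j : nat) : Om -> b.-tuple T :=
  joint (fun i => Z (j.+1 * (k + i).+1)%N) b.

Definition block_sum b (x : l.-tuple (b.-tuple T)) : R :=
  \sum_(i < b) F (slice x i).

Lemma measurable_block Z b k j :
  (forall n, measurable_fun setT (Z n)) -> measurable_fun setT (block Z b k j).
Proof. by move=> mZ; apply: measurable_joint => i; exact: mZ. Qed.

Lemma measurable_block_sum b : measurable_fun setT (@block_sum b).
Proof.
apply: measurable_sum => i; apply: (measurableT_comp mF); exact: measurable_slice.
Qed.

Lemma slice_block Z b k (t : l.-tuple Om) (i : 'I_b) :
  slice (coordwise (block Z b k) t) i =
  coordwise (fun j => Z (j.+1 * (k + i).+1)%N) t.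
Proof. by apply: eq_from_tnth => j; rewrite !tnth_mktuple. Qed.

Lemma joint_coordwise dS (S : measurableType dS) (f : nat -> Om -> S) w :
  joint f l w = coordwise f [tuple w | _ < l].
Proof. by apply: eq_from_tnth => j; rewrite !tnth_mktuple. Qed.

(** The sample points are free, one for each multiplier: the same bound then serves under [P], with
    a constant tuple, and under [tuple_prob P l]. *)
Definition close_off Bad (X Z : nat -> Om -> T) (eps : R) :=
  forall (n : nat -> nat) (t : l.-tuple Om), (forall j, (1 <= n j)%N) ->
    (forall j : 'I_l, ~ Bad (n j) (tnth t j)) ->
    `|F (coordwise (fun j => X (n j)) t) - F (coordwise (fun j => Z (n j)) t)|
      <= eps.

Definition bad_block Bad (b k j : nat) : set Om :=
  [set w | exists2 i, (i < b)%N & Bad (j.+1 * (k + i).+1)%N w].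

Lemma measurable_bad_block Bad b k j :
  (forall n, measurable (Bad n)) -> measurable (bad_block Bad b k j).
Proof.
move=> mBad; rewrite (_ : bad_block _ _ _ _ =
    \big[setU/set0]_(i < b) Bad (j.+1 * (k + i).+1)%N).
  by apply: bigsetU_measurable => i _; exact: mBad.
rewrite -(bigcup_mkord b (fun i => Bad (j.+1 * (k + i).+1)%N)).
by apply/seteqP; split=> w [i ilt Bw]; exists i.
Qed.

Lemma pr_bad_block Bad (e : R) b k j :
  (forall n, measurable (Bad n)) ->
  (forall n, (1 <= n)%N -> pr P (Bad n) <= e) ->
  pr P (bad_block Bad b k j) <= b%:R * e.
Proof.
move=> mBad Bade.
apply: (le_trans (@pr_bigcup _ _ _ P b (fun i => Bad (j.+1 * (k + i).+1)%N) _ _ _ _)) => //.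
  exact: measurable_bad_block.
rewrite mulr_natl -[X in _ *+ X]card_ord -sumr_const.
by apply: ler_sum => i _; apply: Bade; rewrite mulnS.
Qed.

Lemma block_sum_close Bad X Z eps b k (t : l.-tuple Om) :
  close_off Bad X Z eps ->
  (forall j : 'I_l, ~ bad_block Bad b k j (tnth t j)) ->
  `|block_sum (coordwise (block X b k) t) - block_sum (coordwise (block Z b k) t)|
    <= b%:R * eps.
Proof.
move=> cl nbad; rewrite /block_sum -sumrB.
apply: (le_trans (ler_norm_sum _ _ _)).
rewrite mulr_natl -[X in _ *+ X]card_ord -sumr_const.
apply: ler_sum => i _; rewrite !slice_block; apply: cl => [j|j Bj].
  by rewrite mulnS.
by apply: (nbad j); exists i.
Qed.

(** * Events on many separated windows *)

Section separated_blocks.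
Variable Fm : \bar int -> \bar int -> set (set Om).
Hypothesis hFm : monotone_sigma_algebras Fm.
Variables (b m g N k0 h : nat) (c e eps q : R) (B B1 B2 : set R).
Variables (X Z : nat -> Om -> T) (Bad : nat -> set Om).
Hypotheses (mX : forall n, measurable_fun setT (X n))
  (mZ : forall n, measurable_fun setT (Z n))
  (mBad : forall n, measurable (Bad n))
  (mB : measurable B) (mB1 : measurable B1) (mB2 : measurable B2).
Hypothesis wZ : forall n, (1 <= n)%N -> sub_measurable (window Fm n m) (Z n).
Hypothesis prBad : forall n, (1 <= n)%N -> pr P (Bad n) <= e.
Hypothesis cl : close_off Bad X Z eps.
Hypotheses (c0 : 0 <= c) (psic : (psi P Fm g <= c%:E)%E).
Hypothesis BB1 : forall u v, `|u - v| <= b%:R * eps -> B u -> B1 v.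
Hypothesis B1B2 : forall u v, `|u - v| <= b%:R * eps -> B1 u -> B2 v.
Hypothesis hge : (b + m.*2 + g <= h)%N.
Hypothesis k0ge : (l * (N.-1 * h + b) + m.*2 + g <= k0)%N.
Hypothesis law : forall k, pr (tuple_prob P l)
  (@coordwise _ _ _ _ (block X b k) l @^-1` (@block_sum b @^-1` B2)) <= q.

Let zeta s j := block Z b (k0 + s * h) j.

Lemma sub_measurable_block k j (x y : \bar int) : (x <= y)%E ->
  (x <= ((j.+1 * k.+1)%N%:Z - m%:Z)%:E)%E ->
  (((j.+1 * (k + b))%N%:Z + m%:Z)%:E <= y)%E ->
  sub_measurable (Fm x y) (block Z b k j).
Proof.
have [salg [_ mono]] := hFm.
move=> xy xle yge; apply: sub_measurable_joint; first exact: salg.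
move=> i ib; apply: (sub_measurableS _ (wZ _)); last by rewrite mulnS.
apply: mono.
- by rewrite lee_fin; lia.
- by apply: (le_trans xle); rewrite lee_fin; nia.
- by apply: le_trans yge; rewrite lee_fin; nia.
Qed.

(** For a fixed multiplier, [h >= b + 2 m + g] leaves a gap [g] between blocks enlarged by [m] on
    both sides; multiplication of the indices by [j + 1] can only widen it. *)
Lemma quasi_indep_later s n j :
  quasi_indep P (1 + c) (zeta s j) (joint (fun i => zeta (s.+1 + i)%N j) n).
Proof.
have [salg _] := hFm.
apply: (psi_quasi_indep (k := (j.+1 * (k0 + s * h + b) + m)%N) hFm c0 psic).
  by apply: sub_measurable_block; rewrite ?leNye.
apply: sub_measurable_joint; first by apply: salg; rewrite leey.
move=> i _; apply: sub_measurable_block; rewrite ?leey//.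
rewrite lee_fin.
have : (j.+1 * (k0 + s * h + b) + m + g + m <= j.+1 * (k0 + (s.+1 + i) * h).+1)%N.
  have : (s * h + b + m.*2 + g <= (s.+1 + i) * h)%N by nia.
  set u := (s * h)%N; set v := ((s.+1 + i) * h)%N => uv; nia.
lia.
Qed.

(** Multiplier [i + 1] reaches at most [(i + 1) (k0 + (N - 1) h + b)], while the following ones
    start beyond [(i + 2) k0]. The extra [k0] must cover [(i + 1) ((N - 1) h + b) + 2 m + g], whence
    the lower bound on [k0] with [l] in place of [i + 1]. *)
Lemma quasi_indep_later_multiple i n : (i + n.+1 = l)%N ->
  quasi_indep P (1 + c) (joint (fun s => zeta s i) N)
    (joint (fun j => joint (fun s => zeta s (i.+1 + j)%N) N) n).
Proof.
have [salg _] := hFm.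
move=> inl.
apply: (psi_quasi_indep
  (k := (i.+1 * (k0 + N.-1 * h + b) + m)%N) hFm c0 psic).
  apply: sub_measurable_joint; first by apply: salg; rewrite leNye.
  move=> s sN; apply: sub_measurable_block; rewrite ?leNye// lee_fin.
  have : (s * h <= N.-1 * h)%N by rewrite leq_mul2r; apply/orP; right; lia.
  by set u := (s * h)%N; set v := (N.-1 * h)%N; nia.
apply: sub_measurable_joint; first by apply: salg; rewrite leey.
move=> j _; apply: sub_measurable_joint; first by apply: salg; rewrite leey.
move=> s sN; apply: sub_measurable_block; rewrite ?leey// lee_fin.
suff : (i.+1 * (k0 + N.-1 * h + b) + m + g + m <= (i.+1 + j).+1 * (k0 + s * h).+1)%N.
  by lia.
move: k0ge; rewrite -inl; set u := (s * h)%N; set v := (N.-1 * h)%N => k0ge'.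
have : (i.+1 * (v + b) <= (i + n.+1) * (v + b))%N by rewrite leq_mul2r; lia.
by nia.
Qed.

Lemma pr_bad_coordinate k :
  pr (tuple_prob P l)
    [set t | exists j : 'I_l, bad_block Bad b k j (tnth t j)] <=
  (l * b)%:R * e.
Proof.
have mbad j := measurable_bad_block b k j mBad.
pose A j : set (l.-tuple Om) :=
  if insub j is Some j' then [set t | bad_block Bad b k j (tnth t (j' : 'I_l))]
  else set0.
have AE (j : 'I_l) : A j = [set t | bad_block Bad b k j (tnth t j)].
  by rewrite /A valK.
have mA j : measurable (A j).
  rewrite /A; case: insubP => // j' _ <-.
  exact: (measurable_preimage (measurable_tnth j') (mbad j')).
apply: (le_trans (@pr_bigcup _ _ _ (tuple_prob P l) l A _ _ _ _)) => //.
- rewrite (_ : [set _ | _] = \big[setU/set0]_(j < l) A j).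
    by apply: bigsetU_measurable.
  rewrite -(bigcup_mkord l A); apply/seteqP; split=> t /=.
    by move=> [j bj]; exists (val j); [exact: (ltn_ord j)|rewrite AE].
  by move=> [j jl]; have -> := AE (Ordinal jl) => bj; exists (Ordinal jl).
- by move=> t [j bj]; exists (val j); [exact: (ltn_ord j)|rewrite AE].
rewrite natrM -mulrA [l%:R * _]mulr_natl -[X in _ *+ X]card_ord -sumr_const.
apply: ler_sum => j _; rewrite AE /pr tuple_prob_marginal//.
exact: pr_bad_block.
Qed.

(** The way back from [Z] to [X], in the product space, where [law] bounds the probability for the
    block sum of [X]. *)
Lemma pr_block_enlarged s :
  pr (tuple_prob P l)
    (@coordwise _ _ _ _ (zeta s) l @^-1` (@block_sum b @^-1` B1)) <=
  q + (l * b)%:R * e.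
Proof.
have mcX := measurable_coordwise (r := l) (fun j => measurable_block (b := b) (k0 + s * h) j mX).
have mcZ := measurable_coordwise (r := l) (fun j => measurable_block (b := b) (k0 + s * h) j mZ).
have mS A : measurable A -> measurable (@block_sum b @^-1` A).
  by move=> mA; exact: (measurable_preimage (@measurable_block_sum b) mA).
have mbad : measurable
    [set t : l.-tuple Om | exists j : 'I_l, bad_block Bad b (k0 + s * h) j (tnth t j)].
  rewrite (_ : [set _ | _] = \bigcup_(j in [set: 'I_l])
      ((@tnth l Om)^~ j @^-1` bad_block Bad b (k0 + s * h) j)).
    apply: fin_bigcup_measurable => // j _.
    by apply: measurable_preimage; [exact: measurable_tnth|
      exact: measurable_bad_block].
  by apply/seteqP; split=> t [j] => [|_]; exists j.
have mcX2 : measurable (@coordwise _ _ _ _ (block X b (k0 + s * h)) l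
    @^-1` (@block_sum b @^-1` B2)) by exact: (measurable_preimage mcX (mS _ mB2)).
have mcZ1 : measurable (@coordwise _ _ _ _ (zeta s) l
    @^-1` (@block_sum b @^-1` B1)) by exact: (measurable_preimage mcZ (mS _ mB1)).
have := pr_setU (tuple_prob P l) mcX2 mbad mcZ1; move/(_ _)/le_trans; apply.
  move=> t /= Zt.
  have [bad|nbad] := pselect (exists j : 'I_l, bad_block Bad b (k0 + s * h) j (tnth t j)).
    by right.
  left; apply: B1B2 Zt; rewrite distrC; apply: block_sum_close => [|j bj].
    exact: cl.
  by apply: nbad; exists j.
by apply: lerD; [exact: law|exact: pr_bad_coordinate].
Qed.

Lemma pr_bad_union :
  pr P [set w | exists2 s, (s < N)%N & exists2 j, (j < l)%N &
    bad_block Bad b (k0 + s * h) j w] <= (N * l * b)%:R * e.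
Proof.
have mU (I : nat) (A : nat -> set Om) : (forall i, measurable (A i)) ->
    measurable [set w | exists2 i, (i < I)%N & A i w].
  move=> mA; rewrite (_ : [set _ | _] = \big[setU/set0]_(i < I) A i).
    exact: bigsetU_measurable.
  by rewrite -(bigcup_mkord I A); apply/seteqP; split=> w [i]; exists i.
have mbad k j := measurable_bad_block b k j mBad.
pose A s := [set w | exists2 j, (j < l)%N & bad_block Bad b (k0 + s * h) j w].
have mA s : measurable (A s) by apply: mU.
apply: (le_trans (@pr_bigcup _ _ _ P N A _ _ _ _)) => //; first exact: mU.
rewrite -mulnA natrM -mulrA [N%:R * _]mulr_natl -[X in _ *+ X]card_ord -sumr_const.
apply: ler_sum => s _.
apply: (le_trans (@pr_bigcup _ _ _ P l
  (fun j => bad_block Bad b (k0 + s * h) j) _ _ _ _)) => //.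
rewrite natrM -mulrA [l%:R * _]mulr_natl -[X in _ *+ X]card_ord -sumr_const.
by apply: ler_sum => j _; exact: pr_bad_block.
Qed.

(** [B] constrains the sums of [X], [B1] those of [Z], and [B2] those of [X] again under the product
    law, so the error [eps] is paid twice. Separating the multipliers costs [(1 + c) ^ l],
    separating the windows in all [l] coordinates [(1 + c) ^ (l * N)]. *)
Lemma pr_separated_blocks :
  pr P [set w | forall s : 'I_N,
    B (block_sum (joint (block X b (k0 + s * h)) l w))] <=
  (N * l * b)%:R * e +
  (1 + c) ^+ (l + l * N) * (q + (l * b)%:R * e) ^+ N.
Proof.
have C0 : 0 <= 1 + c by rewrite addr_ge0.
have mS A : measurable A -> measurable (@block_sum b @^-1` A).
  by move=> mA; exact: (measurable_preimage (@measurable_block_sum b) mA).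
have mz s j : measurable_fun setT (zeta s j) by exact: measurable_block.
pose xi j := joint (fun s => zeta s j) N.
have mxi j : measurable_fun setT (xi j) by apply: measurable_joint => s; exact: mz.
pose E A := [set x : l.-tuple (N.-tuple (b.-tuple T)) |
  forall s : 'I_N, (@block_sum b @^-1` A) (slice x s)].
have mE A : measurable A -> measurable (E A).
  by move=> mA; apply: (@measurable_all_slices _ _ _ N (fun=> @block_sum b @^-1` A)) => s; exact: mS.
have mev A (Y : nat -> Om -> T) : measurable A -> (forall n, measurable_fun setT (Y n)) ->
    measurable [set w | forall s : 'I_N, A (block_sum (joint (block Y b (k0 + s * h)) l w))].
  move=> mA mY.
  rewrite (_ : [set _ | _] = joint (fun j => joint (fun s => block Y b (k0 + s * h) j) N) l @^-1` E A).
    apply: measurable_preimage; last exact: mE.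
    apply: measurable_joint => j; apply: measurable_joint => s; exact: measurable_block.
  by apply/seteqP; split=> w /= H s; have := H s; rewrite /= slice_joint_joint.
have mbad k j := measurable_bad_block b k j mBad.
have mU (I : nat) (A : nat -> set Om) : (forall i, measurable (A i)) ->
    measurable [set w | exists2 i, (i < I)%N & A i w].
  move=> mA; rewrite (_ : [set _ | _] = \big[setU/set0]_(i < I) A i).
    exact: bigsetU_measurable.
  by rewrite -(bigcup_mkord I A); apply/seteqP; split=> w [i]; exists i.
apply: (le_trans (pr_setU P
  (A := [set w | exists2 s, (s < N)%N & exists2 j, (j < l)%N &
    bad_block Bad b (k0 + s * h) j w])
  (B := [set w | forall s : 'I_N, B1 (block_sum (joint (zeta s) l w))]) _ _ _ _)).
- by apply: (mU N) => s; exact: mU.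
- exact: (mev B1 Z).
- exact: (mev B X).
- move=> w /= Bw.
  have [bad|nbad] := pselect (exists2 s, (s < N)%N & exists2 j, (j < l)%N &
    bad_block Bad b (k0 + s * h) j w); [by left|right=> s].
  have := Bw s; rewrite !joint_coordwise; apply: BB1.
  apply: block_sum_close => [|j]; first exact: cl.
  rewrite tnth_mktuple => bj; apply: nbad; exists (val s); first exact: (ltn_ord s).
  by exists (val j) => //; exact: (ltn_ord j).
apply: lerD; first exact: pr_bad_union.
have -> : [set w | forall s : 'I_N, B1 (block_sum (joint (zeta s) l w))] =
    joint xi l @^-1` E B1.
  by apply/seteqP; split=> w /= H s; have := H s; rewrite /= slice_joint_joint.
have := joint_le_tuple_prob C0 mxi quasi_indep_later_multiple (mE _ mB1).
have mcE : measurable (@coordwise _ _ _ _ xi l @^-1` E B1).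
  exact: (measurable_preimage (measurable_coordwise mxi) (mE _ mB1)).
rewrite !prE//; last exact: (measurable_preimage (measurable_joint mxi) (mE _ mB1)).
rewrite -EFinM lee_fin => /le_trans; apply.
rewrite exprD -mulrA ler_wpM2l ?exprn_ge0//.
have -> : @coordwise _ _ _ _ xi l @^-1` E B1 =
    [set t | forall s : 'I_N, (@block_sum b @^-1` B1) (coordwise (zeta s) t)].
  by apply/seteqP; split=> t /= H s; have := H s; rewrite /= slice_coordwise_joint.
have := @tuple_prob_slices _ _ _ P _ _ l _ N zeta (fun=> @block_sum b @^-1` B1)
  C0 mz (fun=> mS _ mB1) quasi_indep_later.
move/le_trans; apply.
rewrite ler_wpM2l ?exprn_ge0// -[X in _ ^+ X]card_ord -prodr_const.
by apply: ler_prod => s _; rewrite pr_ge0/=; exact: pr_block_enlarged.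
Qed.

End separated_blocks.
End blocks.

(** * Law of the block sums *)

Section law_of_blocks.
Context d (Om : measurableType d) (R : realType) (P : probability Om R).
Context d' (Om' : measurableType d') (Q : probability Om' R).
Variables (p l : nat) (F : l.-tuple (p.-tuple R) -> R).
Hypothesis mF : measurable_fun setT F.
Local Notation T := (p.-tuple R).
Variables (X : nat -> Om -> T) (Y : 'I_l -> nat -> Om' -> T).
Hypotheses (mX : forall n, measurable_fun setT (X n))
  (mY : forall j n, measurable_fun setT (Y j n)).
Hypothesis hstat : stationary P X.
Hypothesis hcopies : forall j, same_law P Q X (Y j).
Hypothesis hindep : independent_processes Q Y.

Definition copies_sum b (w : Om') : R :=
  \sum_(i < b) F [tuple Y j (j.+1 * i.+1)%N w | j < l].

Lemma measurable_copies_sum b : measurable_fun setT (copies_sum b).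
Proof.
apply: measurable_sum => i; apply: (measurableT_comp mF).
apply/measurable_fun_tnthP => j; rewrite (_ : _ \o _ = Y j (j.+1 * i.+1)%N)//.
by apply/funext => w /=; rewrite tnth_mktuple.
Qed.

(** The shift that brings a block back to the origin is [(j + 1) k] and depends on [j]; stationarity
    is therefore applied to one block at a time. *)
Lemma block_law b k (j : 'I_l) A : measurable A ->
  P (block X b k j @^-1` A) = Q (joint (fun i => Y j (j.+1 * i.+1)%N) b @^-1` A).
Proof.
move=> mA; pose t : b.-tuple nat := [tuple (j.+1 * i.+1)%N | i < b].
have t1 i : (1 <= tnth t i)%N by rewrite tnth_mktuple.
rewrite (_ : joint _ b = fidi (Y j) t); last first.
  by apply/funext => w; apply: eq_from_tnth => i; rewrite !tnth_mktuple.
rewrite hcopies// -(hstat (j.+1 * k)%N t1 mA).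
suff -> : block X b k j = fidi X [tuple (tnth t i + j.+1 * k)%N | i < b] by [].
apply/funext => w; apply: eq_from_tnth => i; rewrite !tnth_mktuple.
by congr (X _ w); lia.
Qed.

(** By independence only the laws of the single blocks matter, so the position [k] of the window
    disappears. *)
Lemma tuple_prob_block_sum b k A : measurable A ->
  pr (tuple_prob P l)
    (@coordwise _ _ _ _ (block X b k) l @^-1` (@block_sum _ _ _ F b @^-1` A)) =
  pr Q (copies_sum b @^-1` A).
Proof.
move=> mA; have mS := measurable_preimage (@measurable_block_sum _ _ _ F mF b) mA.
rewrite /pr; congr fine.
rewrite (@tuple_prob_joint _ _ _ P _ _ Q _ _ l (block X b k)
  (fun j => joint (fun i => Y j (j.+1 * i.+1)%N) b))//.
- apply: congr1; apply/seteqP; split=> w /=; rewrite /copies_sum /block_sum.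
    under eq_bigr do rewrite /slice; move=> H; congr (A _): H.
    by apply: eq_bigr => i _; congr F; apply: eq_from_tnth => j; rewrite !tnth_mktuple.
  move=> H; congr (A _): H.
  by apply: eq_bigr => i _; congr F; apply: eq_from_tnth => j; rewrite !tnth_mktuple.
- by move=> j; exact: measurable_block.
- by move=> j; exact: measurable_joint.
- by move=> j B mB; exact: block_law.
- move=> B mB.
  have := hindep (J := finset.setTfor 'I_l)
    (A := fun j => joint (fun i => Y j (j.+1 * i.+1)%N) b @^-1` B j).
  rewrite (eq_bigl xpredT); last by move=> j; rewrite finset.inE.
  move=> <-.
    by congr (Q _); apply/seteqP; split=> w H j _; apply: H => //=; rewrite finset.inE.
  move=> j _; apply: sub_measurable_preimage (mB j).
  apply: sub_measurable_joint; first exact: smallest_sigma_algebra.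
  move=> i _ C preC; apply: sub_sigma_algebra; exists (j.+1 * i.+1)%N => //.
Qed.

Lemma SigmaB b k w :
  Sigma F X (k + b) w - Sigma F X k w = block_sum F (joint (block X b k) l w).
Proof.
rewrite /Sigma (@big_cat_nat _ _ _ k.+1)//=; last by rewrite ltnS leq_addr.
rewrite [LHS]addrC addKr -{1}[k.+1]add0n big_addn subSS addKn big_mkord.
apply: eq_bigr => i _; congr F; apply: eq_from_tnth => j.
by rewrite !tnth_mktuple; congr (X _ w); lia.
Qed.

End law_of_blocks.

(** * Approximation by variables measurable on finite windows *)

Section edist_measurability.
Context d (Om : measurableType d) (R : realType) (p : nat).

Lemma measurable_edist (f g : Om -> p.-tuple R) :
  measurable_fun setT f -> measurable_fun setT g ->
  measurable_fun setT (fun w => Defs.edist (f w) (g w)).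
Proof.
move=> mf mg; rewrite /Defs.edist.
apply: (measurableT_comp (continuous_measurable_fun (@sqrt_continuous R))).
apply: measurable_sum => j; apply: measurable_funX; apply: measurable_funB.
  exact: (measurableT_comp (measurable_tnth j) mf).
exact: (measurableT_comp (measurable_tnth j) mg).
Qed.

End edist_measurability.

Section approximation.
Context d (Om : measurableType d) (R : realType) (P : probability Om R).
Variables (p l : nat) (F : l.-tuple (p.-tuple R) -> R).
Hypotheses (l0 : (0 < l)%N).
Local Notation T := (p.-tuple R).
Variable Fm : \bar int -> \bar int -> set (set Om).
Hypothesis hFm : monotone_sigma_algebras Fm.
Variable X : nat -> Om -> T.
Hypothesis mX : forall n, measurable_fun setT (X n).

(* The common consequence of the regularity conditions (A) and (B). *)
Definition approximable := forall eps : R, 0 < eps ->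
  exists (K kap : R) (m0 : nat), [/\ 0 <= K, 0 < kap & forall m, (m0 <= m)%N ->
    exists (Z : nat -> Om -> T) (Bad : nat -> set Om),
      [/\ forall n, measurable_fun setT (Z n), forall n, measurable (Bad n),
          forall n, (1 <= n)%N -> sub_measurable (window Fm n m) (Z n),
          forall n, (1 <= n)%N -> pr P (Bad n) <= K * expR (- kap * m%:R) &
          close_off F Bad X Z eps]].

(** The process is its own approximation, with empty exceptional events; hence [K = 0]. *)
Lemma regularityA_approximable : regularityA Fm X -> approximable.
Proof.
move=> [m1 _ wX] eps eps0; exists 0, 1, m1; split=> // m m1m.
have [_ [_ mono]] := hFm.
exists X, (fun=> set0); split=> //.
- move=> n n1; apply: (sub_measurableS _ (wX n n1)).
  by apply: mono; rewrite lee_fin; lia.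
- by move=> n _; rewrite /pr measure0 mul0r.
- by move=> n t _ _; rewrite subrr normr0 ltW.
Qed.

Lemma markov_edist (kappa delta c : R) (Z : Om -> T) n : 0 < delta ->
  measurable_fun setT Z ->
  ('E_P[fun w => (Defs.edist (X n w) (Z w) `^ kappa)%R] <= c%:E)%E ->
  pr P [set w | delta <= Defs.edist (X n w) (Z w) `^ kappa] <= delta^-1 * c.
Proof.
move=> delta0 mZ Ec.
have mpow : measurable_fun setT (fun w => Defs.edist (X n w) (Z w) `^ kappa).
  exact: (measurableT_comp (measurable_powR kappa) (measurable_edist (mX n) mZ)).
have := @markov _ _ _ P (mfun_of mpow) id delta delta0 (@measurable_id _ _ setT).
move=> /(_ (fun _ H => H) (fun _ _ _ _ H => H)).
rewrite (_ : [set x | _] = [set w | delta <= Defs.edist (X n w) (Z w) `^ kappa]); last first.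
  by apply/seteqP; split=> w /=; rewrite lee_fin ger0_norm// powR_ge0.
rewrite (_ : id \o _ \o _ = (fun w => Defs.edist (X n w) (Z w) `^ kappa)); last first.
  by apply/funext => w /=; rewrite ger0_norm// powR_ge0.
move=> /le_trans /(_ Ec).
rewrite prE; last first.
  rewrite (_ : [set w | _] = (fun w => Defs.edist (X n w) (Z w) `^ kappa) @^-1` `[delta, +oo[%classic).
    exact: (measurable_preimage mpow).
  by apply/seteqP; split=> w /=; rewrite in_itv/= andbT.
by rewrite -EFinM lee_fin [delta^-1 * _]mulrC ler_pdivlMr// [pr _ _ * delta]mulrC.
Qed.

(** [Z n] is the conditional expectation on the window, and [Bad n] is where the [kappa2]-th power
    of its distance to [X n] reaches [delta]; Markov's inequality makes this exponentially
    unlikely. *)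
Lemma regularityB_approximable : regularityB P Fm X F -> approximable.
Proof.
move=> [kappa2 k20 [holder [kappa3 k30 approx]]] eps eps0.
have [salg [meas _]] := hFm.
(* With [l] arguments each contributing at most [delta], the Hoelder bound gives
   [kappa2^-1 * (l * delta) = eps]. *)
pose delta := eps * kappa2 / l%:R.
have lR : 0 < l%:R :> R by rewrite ltr0n.
have delta0 : 0 < delta by rewrite /delta divr_gt0// mulr_gt0.
exists (delta^-1 * kappa3^-1), kappa3, 1%N; split=> //.
  by rewrite mulr_ge0 ?invr_ge0// ltW.
move=> m m1.
have wle (n : nat) : ((n%:Z - m%:Z)%:E <= (n%:Z + m%:Z)%:E)%E by rewrite lee_fin; lia.
have [Z HZ] : {Z : nat -> Om -> T & forall n,
    measurable_fun setT (Z n) /\ ((1 <= n)%N -> sub_measurable (window Fm n m) (Z n) /\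
     ('E_P[fun w => (Defs.edist (X n w) (Z n w) `^ kappa2)%R] <=
           (kappa3^-1 * expR (- kappa3 * m%:R))%:E)%E)}.
  apply: (@choice _ _ (fun n (Zn : Om -> T) => measurable_fun setT Zn /\
    ((1 <= n)%N -> sub_measurable (window Fm n m) Zn /\
     ('E_P[fun w => (Defs.edist (X n w) (Zn w) `^ kappa2)%R] <=
           (kappa3^-1 * expR (- kappa3 * m%:R))%:E)%E))) => n.
  (* Index 0 has no conditional expectation attached; any measurable variable will do there. *)
  case: n => [|n]; first by exists (X 0%N).
  have [Zn ce EZn] := approx n.+1 m isT m1.
  have wZn : sub_measurable (window Fm n.+1 m) Zn.
    apply: sub_measurable_tuple; first exact: salg.
    by move=> j; have [] := ce j.
  exists Zn; split=> //.
  by apply: sub_measurable_fun wZn; exact: meas.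
have mZ n : measurable_fun setT (Z n) by have [] := HZ n.
exists Z, (fun n => [set w | delta <= Defs.edist (X n w) (Z n w) `^ kappa2]); split=> //.
- move=> n; rewrite (_ : [set w | _] =
      (fun w => Defs.edist (X n w) (Z n w) `^ kappa2) @^-1` `[delta, +oo[%classic).
    apply: measurable_preimage => //.
    exact: (measurableT_comp (measurable_powR kappa2) (measurable_edist (mX n) (mZ n))).
  by apply/seteqP; split=> w /=; rewrite in_itv/= andbT.
- by move=> n n1; have [_ /(_ n1)[]] := HZ n.
- move=> n n1; rewrite -mulrA; apply: markov_edist => //.
  by have [_ /(_ n1)[]] := HZ n.
- move=> n t n1 nbad; apply: (le_trans (holder _ _)).
  rewrite mulrC ler_pdivrMr//.
  apply: (@le_trans _ _ (\sum_(i < l) delta)).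
    apply: ler_sum => i _; rewrite !tnth_mktuple.
    by rewrite leNgt; apply/negP => /ltW; exact: nbad.
  by rewrite sumr_const card_ord -mulr_natr /delta divfK ?gt_eqF.
Qed.

End approximation.

(** * The rate function *)

Section rate_function.
Context (R : realType).
Variable Pi : R -> R.

Lemma difference_quotient (f : R -> R) (x : R) : derivable f x 1 ->
  forall eta : R, 0 < eta -> exists2 r : R, 0 < r & forall h : R, `|h| < r ->
    `|f (x + h) - f x - h * derive1 f x| <= `|h| * eta.
Proof.
move=> df eta eta0.
have /cvgrPdist_lt /(_ eta eta0) : (fun h : R => h^-1 *: (f (h *: (1:R) + x) - f x)) @ 0^'
    --> derive1 f x.
  by rewrite derive1E; exact: df.
move=> /nbhs_ballP[r /= r0 Hr]; exists r => // h hr.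
have [->|h0] := eqVneq h 0; first by rewrite addr0 subrr mul0r subrr normr0 mul0r.
have := Hr h; rewrite /ball/= sub0r normrN => /(_ hr h0).
rewrite /GRing.scale/= mulr1 (addrC h x) => /ltW.
rewrite -(ler_pM2l (x := `|h|)) ?normr_gt0// -normrM mulrBr mulrA divff// mul1r.
by rewrite distrC.
Qed.

Hypothesis hPi : admissible_Pi Pi.
Hypothesis Pi0 : Pi 0 = 0.

(** The chord inequality at [a + s (y - a)] is compared with the first order expansion of [Pi] at
    [a] for a small [s]; the resulting error [e] is arbitrary. *)
Lemma tangent_line a y : Pi a + derive1 Pi a * (y - a) <= Pi y.
Proof.
have [conv dPi _ _ _] := hPi.
have [->|ya] := eqVneq y a; first by rewrite subrr mulr0 addr0.
have nya : 0 < `|y - a| by rewrite normr_gt0 subr_eq0.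
apply/ler_addgt0Pr => e e0.
have [r r0 Hr] := difference_quotient (dPi a) (divr_gt0 e0 nya).
pose s := Num.min 2^-1 (r / (2 * `|y - a|)).
have s0 : 0 < s by rewrite /s lt_min invr_gt0 ltr0n divr_gt0// mulr_gt0.
have s1 : s <= 1 by rewrite /s ge_min invf_le1 ?ler1n.
have sr : `|s * (y - a)| < r.
  rewrite normrM (gtr0_norm s0) -ltr_pdivlMr//.
  apply: (@le_lt_trans _ _ (r / (2 * `|y - a|))); first by rewrite /s ge_min lexx orbT.
  by rewrite ltr_pM2l// ltf_pV2 ?posrE ?mulr_gt0// ltr_pMl ?ltr1n.
have s01 : 0 <= s <= 1 by rewrite (ltW s0) s1.
pose t : {i01 R} := Itv01 (ltW s0) s1.
have := conv t y a; rewrite !inE => /(_ I I).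
rewrite !convRE/= => cv.
have := Hr _ sr; rewrite ler_norml => /andP[Hl _].
have {}cv : Pi (a + s * (y - a)) <= s * Pi y + (1 - s) * Pi a.
  apply: le_trans cv; rewrite (_ : a + s * (y - a) = s * y + (1 - s) * a)//.
  by ring.
have sE : s * `|y - a| * (e / `|y - a|) = s * e.
  by rewrite -mulrA [`|y - a| * _]mulrC divfK ?gt_eqF.
move: Hl; rewrite normrM (gtr0_norm s0) sE => Hl.
rewrite -(ler_pM2l s0); lra.
Qed.

(** Were [a <= 0], the tangents at [a] and at 0 would squeeze [Pi a] to 0 and force [a = 0], where
    the derivative vanishes. *)
Lemma derivative_ge a : 0 < derive1 Pi a -> 0 < a.
Proof.
have [_ _ _ dPi0 _] := hPi => da.
rewrite ltNge; apply/negP => a0.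
have := tangent_line a 0; have := tangent_line 0 a.
rewrite dPi0 mul0r addr0 Pi0 sub0r => h1 h2.
have {h2} : Pi a <= derive1 Pi a * a by lra.
move=> h2; have : Pi a = 0.
  by apply/eqP; rewrite eq_le h1 andbT; apply: (le_trans h2); rewrite mulr_ge0_le0// ltW.
move=> Pia0; have /eqP : derive1 Pi a * a = 0.
  by apply/eqP; rewrite eq_le mulr_ge0_le0 ?(ltW da)//= -Pia0.
rewrite mulf_eq0 gt_eqF//= => /eqP a00.
by move: da; rewrite a00 dPi0 ltxx.
Qed.

Variable beta : R.
Hypotheses (beta_gt0 : 0 < beta) (beta_lt : (beta%:E < beta0 Pi)%E).

(** This is where [beta < beta0] enters. Otherwise [Pi a <= a * beta] for all [a >= 0], so at a
    point [b > beta] of finite rate [a * b - Pi a >= a * (b - beta)] would be unbounded. *)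
Lemma derivative_exceeds : exists2 a, 0 <= a & beta <= derive1 Pi a.
Proof.
apply: contrapT => H.
have Hlt a : 0 <= a -> derive1 Pi a < beta.
  by move=> a0; rewrite ltNge; apply/negP => ba; apply: H; exists a.
have [_ [b rb <-]] := ereal_sup_gt beta_lt; rewrite lte_fin => bb.
have Pile a : 0 <= a -> Pi a <= a * beta.
  move=> a0; have := tangent_line a 0; rewrite Pi0 sub0r => h.
  by have := ler_wpM2l a0 (ltW (Hlt a a0)); lra.
have rle a : 0 <= a -> ((a * (b - beta))%:E <= rate Pi b)%E.
  move=> a0; apply: (@le_trans _ _ (a * b - Pi a)%:E).
    by rewrite lee_fin; have := Pile a a0; lra.
  by apply: ereal_sup_ubound; exists a.
have rge0 : (0 <= rate Pi b)%E by have := rle 0 (lexx _); rewrite mul0r.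
have {}rb : (rate Pi b < +oo)%E := rb.
move: rb rge0 rle; case: (rate Pi b) => [r _|h|_ h]; last 2 first.
- by rewrite ltxx in h.
- by rewrite leeNy_eq in h.
rewrite lee_fin => r0 rle.
have bb0 : 0 < b - beta by rewrite subr_gt0.
have := rle ((r + 1) / (b - beta)) (divr_ge0 (addr_ge0 r0 ler01) (ltW bb0)).
by rewrite divfK ?gt_eqF// lee_fin gerDl ler10.
Qed.

Lemma derivative_attains y : 0 < y -> y <= beta ->
  exists2 a, 0 < a & derive1 Pi a = y.
Proof.
move=> y0 yb; have [conv dPi ddPi dPi0 _] := hPi.
have [a a0 ba] := derivative_exceeds.
have [] := @IVT R (derive1 Pi) 0 a y a0.
- apply: derivable_within_continuous => x _; exact: ddPi.
- by rewrite dPi0 ge_min (ltW y0) le_max (le_trans yb ba) orbT.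
move=> c _ cy; exists c => //; apply: derivative_ge; by rewrite cy.
Qed.

Lemma rate_attained a : derive1 Pi a = beta -> rate Pi beta = (a * beta - Pi a)%:E.
Proof.
move=> da; apply/eqP; rewrite eq_le; apply/andP; split.
  apply: ub_ereal_sup => _ [y _ <-]; rewrite lee_fin.
  by have := tangent_line a y; rewrite da; lra.
by apply: ereal_sup_ubound; exists a.
Qed.

Definition speed := fine (rate Pi beta).

Lemma speedE : exists2 a, 0 < a &
  derive1 Pi a = beta /\ speed = a * beta - Pi a.
Proof.
have [a a0 da] := derivative_attains beta_gt0 (lexx _).
by exists a => //; split=> //; rewrite /speed (rate_attained da).
Qed.

Lemma speed_ge a : a * beta - Pi a <= speed.
Proof.
have [a' _ [da' ->]] := speedE.
by have := tangent_line a' a; rewrite da'; lra.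
Qed.

Lemma legendre_gt0 y a : 0 < a -> derive1 Pi a = y -> forall x, y < x -> 0 < a * x - Pi a.
Proof.
move=> a0 da x yx; have := tangent_line a 0; rewrite Pi0 sub0r da => h.
have : a * y < a * x by rewrite ltr_pM2l.
lra.
Qed.

(** The tilt whose slope is [beta / 2] already gives a positive value at [beta]. Hence the block
    constant [1 / I(beta)] is a genuine positive number. *)
Lemma speed_gt0 : 0 < speed.
Proof.
have b2 : 0 < beta / 2 by rewrite divr_gt0.
have b2b : beta / 2 < beta by rewrite ltr_pdivrMr// ltr_pMr// ltr1n.
have [a a0 da] := derivative_attains b2 (ltW b2b).
by apply: lt_le_trans (speed_ge a); exact: (legendre_gt0 a0 da).
Qed.

End rate_function.

(** * Large deviations for the independent copies *)

Section step_integral.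
Context (R : realType).
Local Notation mu := (@lebesgue_measure R).

Lemma truncn_step (n i : nat) (u : R) : (0 < n)%N ->
  u \in `[i%:R / n%:R, i.+1%:R / n%:R[ -> Num.truncn (u * n%:R) = i.
Proof.
move=> n0; rewrite in_itv/= => /andP[iu ui].
have n0R : 0 < n%:R :> R by rewrite ltr0n.
apply/eqP; rewrite truncn_eq.
  by rewrite -ler_pdivrMr// iu/= -ltr_pdivlMr.
by rewrite mulr_ge0 ?(ltW n0R)//; apply: le_trans iu; rewrite divr_ge0.
Qed.

Lemma Rintegral_step (G : nat -> R) (a : R) n : (0 < n)%N ->
  \int[mu]_(u in `[0, 1]) (a * G (Num.truncn (u * n%:R))) =
  n%:R^-1 * (a * \sum_(0 <= k < n) G k).
Proof.
move=> n0; have n0R : 0 < n%:R :> R by rewrite ltr0n.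
pose f (u : R) := a * G (Num.truncn (u * n%:R)).
pose J k : set R := [set` `[0, k%:R / n%:R[].
have mJ k : measurable (J k) by exact: measurable_itv.
have step k : measurable_fun (J k) f /\
    (\int[mu]_(u in J k) (f u)%:E =
    (n%:R^-1 * (a * \sum_(0 <= i < k) G i))%:E)%E.
  elim: k => [|k [mk Ik]].
    rewrite /J mul0r set_itvco0 integral_set0 big_geq// mulr0 mulr0.
    by split=> //; exact: measurable_fun_set0.
  have kk : k%:R / n%:R < k.+1%:R / n%:R :> R.
    by rewrite ltr_pM2r ?invr_gt0// ltr_nat.
  have k0 : 0 <= k%:R / n%:R :> R by rewrite divr_ge0.
  have split_itv : J k.+1 = J k `|` [set` `[k%:R / n%:R, k.+1%:R / n%:R[].
    by apply: itv_bndbnd_setU; rewrite bnd_simp// ltW.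
  have fE : {in [set` `[k%:R / n%:R : R, k.+1%:R / n%:R[], f =1 cst (a * G k)}.
    by move=> u; rewrite inE /= => uk; rewrite /f (truncn_step n0 uk).
  have mkk : measurable_fun [set` `[k%:R / n%:R : R, k.+1%:R / n%:R[] f.
    by apply: (eq_measurable_fun (cst (a * G k))) => // u uk; rewrite fE.
  have mU : measurable_fun (J k.+1) f.
    by rewrite split_itv; apply/measurable_funU.
  split=> //; rewrite split_itv integral_setU_EFin//; last 3 first.
  - exact: measurable_itv.
  - by rewrite -split_itv.
  - apply/disj_setPS => u [/=]; rewrite !in_itv/= => /andP[_ uk] /andP[ku _].
    by have := lt_le_trans uk ku; rewrite ltxx.
  rewrite Ik (eq_integral (fun=> (a * G k)%:E)); last first.
    by move=> u uk; rewrite fE.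
  rewrite integral_cst//= lebesgue_measure_itv/= lte_fin kk -EFinB -EFinM -EFinD.
  congr EFin; rewrite big_nat_recr//= -mulrBl -natrB// subSnn mul1r; ring.
have := step n; rewrite /J divff ?gt_eqF// => -[m1 I1].
(* The endpoint [u = 1], where the index would be [n], has measure zero. *)
by rewrite /Rintegral -integral_itv_bndo_bndc ?I1//; apply/measurable_EFinP.
Qed.

End step_integral.

Section large_deviations.
Context d (Om : measurableType d) (R : realType) (Q : probability Om R).
Variables (S : nat -> Om -> R) (D : R).
Hypotheses (mS : forall b, measurable_fun setT (S b))
  (bS : forall b w, `|S b w| <= D * b%:R).

Definition mgf b (a : R) : R := \int[Q]_w expR (a * S b w).

Lemma integrable_exp b a (c : R) :
  Q.-integrable setT (EFin \o (fun w => c * expR (a * S b w))).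
Proof.
apply: measurable_bounded_integrable => //.
- by rewrite -ge0_fin_numE// fin_num_measure.
- apply: measurable_funM => //; apply: measurableT_comp => //.
  exact: measurable_funM.
- exists (`|c| * expR (`|a| * (D * b%:R))); split; first exact: num_real.
  move=> x xM w _; apply: (le_trans _ (ltW xM)).
  rewrite /= normrM ler_wpM2l// ger0_norm ?expR_ge0// ler_expR.
  apply: (le_trans (ler_norm _)); rewrite normrM; exact: ler_wpM2l.
Qed.

Lemma integrable_exp1 b a : Q.-integrable setT (EFin \o (fun w => expR (a * S b w))).
Proof.
rewrite [X in EFin \o X](_ : _ = (fun w => 1 * expR (a * S b w))).
  exact: integrable_exp.
by apply/funext => w; rewrite mul1r.
Qed.

Lemma integrable_cst_indic (c : R) A : measurable A ->
  Q.-integrable setT (EFin \o (fun w => c * \1_A w)).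
Proof.
move=> mA; apply: measurable_bounded_integrable => //.
- by rewrite -ge0_fin_numE// fin_num_measure.
- exact: measurable_funM.
- exists `|c|; split; first exact: num_real.
  move=> x xM w _; apply: (le_trans _ (ltW xM)).
  by rewrite /= normrM ler_piMr// indicE ger0_norm// lern1; case: (_ \in _).
Qed.

Lemma Rintegral_cst_indic (c : R) A : measurable A ->
  \int[Q]_w (c * \1_A w) = c * pr Q A.
Proof.
move=> mA; rewrite RintegralZl//.
  by rewrite /Rintegral integral_indic// setIT.
rewrite [X in EFin \o X](_ : _ = (fun w => 1 * \1_A w)).
  exact: integrable_cst_indic.
by apply/funext => w; rewrite mul1r.
Qed.

Lemma measurable_level b (x : R) : measurable [set w | x <= S b w].
Proof.
rewrite (_ : [set _ | _] = S b @^-1` `[x, +oo[%classic).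
  exact: (measurable_preimage (mS b)).
by apply/seteqP; split=> w /=; rewrite in_itv/= andbT.
Qed.

Lemma mgf_gt0 b a : 0 < mgf b a.
Proof.
apply: (@lt_le_trans _ _ (expR (- (`|a| * (D * b%:R))))); first exact: expR_gt0.
have -> : expR (- (`|a| * (D * b%:R))) =
    \int[Q]_w (expR (- (`|a| * (D * b%:R))) * \1_[set: Om] w).
  by rewrite Rintegral_cst_indic// /pr probability_setT mulr1.
apply: le_Rintegral => //; [exact: integrable_cst_indic|exact: integrable_exp1|].
move=> w _; rewrite indicT mulr1 ler_expR lerNl.
apply: (le_trans (ler_norm _)); rewrite normrN normrM; exact: ler_wpM2l.
Qed.

Lemma chernoff_level b a x : 0 <= a ->
  pr Q [set w | x <= S b w] <= expR (- (a * x)) * mgf b a.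
Proof.
move=> a0; have mA := measurable_level b x.
rewrite -[leLHS]mul1r -Rintegral_cst_indic// -RintegralZl//; last exact: integrable_exp1.
apply: le_Rintegral => //; first exact: integrable_cst_indic.
  exact: integrable_exp.
move=> w _; rewrite mul1r -expRD indicE.
have [xS|] := boolP (w \in _); last by rewrite expR_ge0.
rewrite inE /= in xS.
by rewrite -expR0 ler_expR addrC subr_ge0 ler_wpM2l.
Qed.

(* The three terms bound expR (a S) on S >= u, on S < v and in between. *)
Lemma mgf_le_level b a t s u v : 0 <= a -> 0 <= t -> 0 <= s ->
  mgf b a <= expR (- (t * u)) * mgf b (a + t) + expR (s * v) * mgf b (a - s) +
             expR (a * u) * pr Q [set w | v <= S b w].
Proof.
move=> a0 t0 s0; have mA := measurable_level b v.
have i1 := integrable_exp b (a + t) (expR (- (t * u))).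
have i2 := integrable_exp b (a - s) (expR (s * v)).
have i3 := integrable_cst_indic (expR (a * u)) mA.
have i12 : Q.-integrable setT (EFin \o (fun w =>
    expR (- (t * u)) * expR ((a + t) * S b w) + expR (s * v) * expR ((a - s) * S b w))).
  exact: (integrableD measurableT i1 i2).
have i123 : Q.-integrable setT (EFin \o (fun w =>
    expR (- (t * u)) * expR ((a + t) * S b w) + expR (s * v) * expR ((a - s) * S b w)
    + expR (a * u) * \1_[set w | v <= S b w] w)).
  exact: (integrableD measurableT i12 i3).
rewrite -Rintegral_cst_indic// -!RintegralZl//; [|exact: integrable_exp1..].
rewrite -RintegralD// -RintegralD//.
apply: le_Rintegral => //; first exact: integrable_exp1.
move=> w _; rewrite -!expRD indicE.
have [uS|Su] := leP u (S b w).
  apply: (@le_trans _ _ (expR (- (t * u) + (a + t) * S b w))).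
    by rewrite ler_expR; have := ler_wpM2l t0 uS; lra.
  by rewrite -addrA lerDl addr_ge0 ?expR_ge0// mulr_ge0 ?expR_ge0.
have [vS|Sv] := leP v (S b w).
  rewrite mem_set// mulr1; apply: (@le_trans _ _ (expR (a * u))).
    by rewrite ler_expR ler_wpM2l// ltW.
  by rewrite lerDr addr_ge0 ?expR_ge0.
apply: (@le_trans _ _ (expR (s * v + (a - s) * S b w))).
  by rewrite ler_expR; have := ler_wpM2l s0 (ltW Sv); lra.
rewrite addrAC lerDr addr_ge0 ?expR_ge0// mulr_ge0 ?expR_ge0//.
Qed.

End large_deviations.

Section tilting_arithmetic.
Context (R : realFieldType).
Implicit Types e g z E W : R.

Lemma le_sub_three (x y e g z : R) :
  x <= y - z -> g <= z -> e <= g / 4 -> x + e <= y - 3 * e.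
Proof. lra. Qed.

(** [E] stands for a lower bound on the moment generating function [m], [k2] and [k3] for its parts
    outside a strip of levels, and [W] for the part inside. *)
Lemma tilting_remainder (E q3 q2 k2 k3 m W : R) :
  4 * q3 <= E -> 2 * q2 <= E -> E <= m -> k2 <= q3 -> k3 <= q3 ->
  m <= k2 + k3 + W -> q2 <= W.
Proof. lra. Qed.

Lemma tilting_exponent (delta e y P : R) : 0 < delta -> e <= delta / 8 ->
  0 <= delta + (y - P) + P - 2 * e - (y + delta / 2).
Proof. lra. Qed.

End tilting_arithmetic.

Section deviation_rates.
Context d (Om : measurableType d) (R : realType) (Q : probability Om R).
Variables (S : nat -> Om -> R) (D : R) (Pi : R -> R) (beta : R).
Hypotheses (mS : forall b, measurable_fun setT (S b))
  (bS : forall b w, `|S b w| <= D * b%:R).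
Hypothesis hmgf : forall a,
  (fun b : nat => b.+1%:R^-1 * ln (mgf Q S b a)) @ \oo --> Pi a.
Hypothesis hPi : admissible_Pi Pi.
Hypotheses (beta_gt0 : 0 < beta) (beta_lt : (beta%:E < beta0 Pi)%E).

(** At [a = 0] the moment generating function is 1 for every [b]. *)
Lemma Pi_zero : Pi 0 = 0.
Proof.
have : (fun b : nat => b.+1%:R^-1 * ln (mgf Q S b 0)) = (fun=> 0).
  apply/funext => b; rewrite (_ : mgf Q S b 0 = 1) ?ln1 ?mulr0//.
  rewrite /mgf (@eq_Rintegral _ _ _ Q setT (fun w => 1 * \1_[set: Om] w)).
    by rewrite Rintegral_cst_indic// /pr probability_setT mulr1.
  by move=> w _; rewrite mul0r expR0 indicT mulr1.
move=> E; have := @hmgf 0; rewrite E => h; apply/esym.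
exact: (cvg_unique _ (cvg_cst _) h).
Qed.

(** The limit is normalized by [b + 1] and the bounds by [b]. Half of [eps] serves the limit; the
    other half absorbs the discrepancy once [b * eps / 2 >= |Pi a| + eps / 2], which is what [b2]
    ensures. *)
Lemma mgf_bounds a eps : 0 < eps -> exists b0, forall b, (b0 <= b)%N ->
  expR (b%:R * (Pi a - eps)) <= mgf Q S b a <= expR (b%:R * (Pi a + eps)).
Proof.
move=> eps0; have e2 : 0 < eps / 2 by rewrite divr_gt0.
have /cvgrPdist_lt /(_ _ e2) [b1 _ Hb1] := @hmgf a.
pose b2 := (Num.truncn (2 * `|Pi a| / eps + 1)).+1.
exists (maxn b1 b2) => b; rewrite geq_max => /andP[bb1 bb2].
have bR : 2 * `|Pi a| / eps + 1 <= b%:R.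
  by apply: (le_trans (ltW (truncnS_gt _))); rewrite ler_nat.
have m0 := mgf_gt0 Q mS bS b a.
have := Hb1 b bb1; rewrite /= ltr_norml => /andP[h1 h2].
have b1R : 0 < b.+1%:R :> R by rewrite ltr0n.
set L := ln (mgf Q S b a) in h1 h2.
have -> : mgf Q S b a = expR L by rewrite lnK.
rewrite !ler_expR.
have key : `|Pi a| + b.+1%:R * (eps / 2) <= b%:R * eps.
  rewrite -natr1.
  have := ler_wpM2r (ltW eps0) bR; rewrite mulrDl divfK ?gt_eqF// mul1r.
  lra.
have LE : L = b.+1%:R * (b.+1%:R^-1 * L) by rewrite mulrA divff ?gt_eqF// mul1r.
set y := b.+1%:R^-1 * L in h1 h2 LE.
have k1 : L <= b.+1%:R * (Pi a + eps / 2).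
  by rewrite LE; apply: ler_wpM2l; [exact: ltW|rewrite -lerBlDl; lra].
have k2 : b.+1%:R * (Pi a - eps / 2) <= L.
  by rewrite [leRHS]LE; apply: ler_wpM2l; [exact: ltW|lra].
have [n1 n2] : - `|Pi a| <= Pi a /\ Pi a <= `|Pi a|.
  by split; [rewrite lerNl -normrN ler_norm|exact: ler_norm].
move: k1 k2 key; rewrite -natr1; set x := Pi a in n1 n2 *; set B := b%:R.
by move=> *; apply/andP; split; lra.
Qed.

Lemma upper_deviation a x rho : 0 <= a -> rho < a * x - Pi a ->
  exists b0, forall b, (b0 <= b)%N ->
    pr Q [set w | x * b%:R <= S b w] <= expR (- (rho * b%:R)).
Proof.
move=> a0 rhol; have e0 : 0 < a * x - Pi a - rho by rewrite subr_gt0.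
have [b0 Hb0] := mgf_bounds a e0; exists b0 => b /Hb0 /andP[_ h].
apply: (le_trans (chernoff_level Q mS bS b _ a0)).
apply: (le_trans (ler_wpM2l (expR_ge0 _) h)).
rewrite -expRD ler_expR; lra.
Qed.

Lemma expR_ge1D (x y : R) : x <= y -> 1 + x <= expR y.
Proof. by move=> xy; apply: le_trans (expR_ge1Dx y); rewrite lerD2l. Qed.

(** Under the law tilted by [expR (a * S)] the sum concentrates at [x * b], so the strip from
    [v * b] to [u * b] carries most of the moment generating function, while there [expR (a * S)] is
    at most [expR (a * u * b)]. *)
Lemma lower_deviation a x v rho : 0 < a -> derive1 Pi a = x -> v < x ->
  a * x - Pi a < rho ->
  exists b0, forall b, (b0 <= b)%N ->
    expR (- (rho * b%:R)) <= pr Q [set w | v * b%:R <= S b w].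
Proof.
move=> a0 dax vx rhog; have [_ dPi _ _ _] := hPi.
have [delta delta0 rhoE] : exists2 delta, 0 < delta & rho = delta + (a * x - Pi a).
  by exists (rho - (a * x - Pi a)); rewrite ?subr_gt0// subrK.
(* [a * u] exceeds [a * x] by [delta / 2], half of the slack in [rho]. *)
pose u := x + delta / (2 * a).
have ux : 0 < u - x by rewrite /u addrC addKr divr_gt0// mulr_gt0.
have eta0 : 0 < (u - x) / 2 by rewrite divr_gt0.
have eta'0 : 0 < (x - v) / 2 by rewrite divr_gt0// subr_gt0.
(* The slope at [a] is [x], with [v < x < u]: small steps [t] to the right and [s] to the left show
   that the parts above [u * b] and below [v * b] are exponentially smaller than the whole. *)
have [t t0 Ht] : exists2 t, 0 < t & Pi (a + t) - t * u <= Pi a - t * ((u - x) / 2).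
  have [r r0 Hr] := difference_quotient (dPi a) eta0.
  have r2 : 0 < r / 2 by rewrite divr_gt0.
  exists (r / 2) => //.
  have := Hr (r / 2); rewrite gtr0_norm// dax => /(_ _)/ler_normlP.
  have rr : r / 2 < r by rewrite ltr_pdivrMr// ltr_pMr// ltr1n.
  move=> /(_ rr)[_ h]; set z := r / 2 in h *; lra.
have [s s0 Hs] : exists2 s, 0 < s & Pi (a - s) + s * v <= Pi a - s * ((x - v) / 2).
  have [r r0 Hr] := difference_quotient (dPi a) eta'0.
  have r2 : 0 < r / 2 by rewrite divr_gt0.
  exists (r / 2) => //.
  have := Hr (- (r / 2)); rewrite normrN gtr0_norm// dax => /(_ _)/ler_normlP.
  have rr : r / 2 < r by rewrite ltr_pdivrMr// ltr_pMr// ltr1n.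
  move=> /(_ rr)[_ h]; set z := r / 2 in h *; lra.
pose g := Num.min (t * ((u - x) / 2)) (s * ((x - v) / 2)).
have g0 : 0 < g by rewrite /g lt_min mulr_gt0// mulr_gt0.
have gt : g <= t * ((u - x) / 2) by rewrite /g ge_min lexx.
have gs : g <= s * ((x - v) / 2) by rewrite /g ge_min lexx orbT.
(* [g / 4] brings both outer parts down to the exponent [Pi a - 3 e]; [delta / 8] leaves room in the
   final exponent. *)
pose e := Num.min (g / 4) (delta / 8).
have e0 : 0 < e by rewrite /e lt_min divr_gt0// divr_gt0.
have eg : e <= g / 4 by rewrite /e ge_min lexx.
have ed : e <= delta / 8 by rewrite /e ge_min lexx orbT.
have [b1 H1] := mgf_bounds a e0.
have [b2 H2] := mgf_bounds (a + t) e0.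
have [b3 H3] := mgf_bounds (a - s) e0.
(* From [e * b >= 3] come the numerical gains [4 <= expR (2 e b)] and [2 <= expR (e b)]. *)
pose b4 := (Num.truncn (3 / e)).+1.
exists (maxn (maxn b1 b2) (maxn b3 b4)) => b.
rewrite !geq_max => /andP[/andP[bb1 bb2] /andP[bb3 bb4]].
have bR : 3 <= e * b%:R.
  rewrite mulrC -ler_pdivrMr//; apply: (le_trans (ltW (truncnS_gt _))).
  by rewrite ler_nat.
have /andP[h1 _] := H1 b bb1; have /andP[_ h2] := H2 b bb2; have /andP[_ h3] := H3 b bb3.
have := mgf_le_level Q mS bS b (u * b%:R) (v * b%:R) (ltW a0) (ltW t0) (ltW s0).
set p := pr Q _ => hp.
have B0 : 0 <= b%:R :> R := ler0n R b.
set B := b%:R in B0 bR h1 h2 h3 hp *.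
have k2 : expR (- (t * (u * B))) * mgf Q S b (a + t) <= expR (B * (Pi a - 3 * e)).
  apply: (le_trans (ler_wpM2l (expR_ge0 _) h2)); rewrite -expRD ler_expR.
  apply: le_trans (ler_wpM2l B0 (le_sub_three Ht gt eg)).
  by rewrite le_eqVlt; apply/orP; left; apply/eqP; ring.
have k3 : expR (s * (v * B)) * mgf Q S b (a - s) <= expR (B * (Pi a - 3 * e)).
  apply: (le_trans (ler_wpM2l (expR_ge0 _) h3)); rewrite -expRD ler_expR.
  apply: le_trans (ler_wpM2l B0 (le_sub_three Hs gs eg)).
  by rewrite le_eqVlt; apply/orP; left; apply/eqP; ring.
have E1 : expR (B * (Pi a - e)) = expR (2 * (e * B)) * expR (B * (Pi a - 3 * e)).
  by rewrite -expRD; congr expR; ring.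
have E2 : expR (B * (Pi a - e)) = expR (e * B) * expR (B * (Pi a - 2 * e)).
  by rewrite -expRD; congr expR; ring.
have c1 : 4 <= expR (2 * (e * B)).
  have eB0 : 0 <= e * B := le_trans (ler0n R 3) bR.
  have /expR_ge1D : 3 <= 2 * (e * B) by rewrite (le_trans bR)// ler_peMl// ler1n.
  by apply: le_trans; rewrite -(natrD _ 1 3).
have c2 : 2 <= expR (e * B) by apply: le_trans (expR_ge1D bR); rewrite lerDl ler0n || rewrite -(natrD _ 1 3) ler_nat.
have q3 := expR_ge0 (B * (Pi a - 3 * e)).
have q2 := expR_ge0 (B * (Pi a - 2 * e)).
have f1 : 4 * expR (B * (Pi a - 3 * e)) <= expR (B * (Pi a - e)).
  by rewrite E1; exact: ler_wpM2r.
have f2 : 2 * expR (B * (Pi a - 2 * e)) <= expR (B * (Pi a - e)).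
  by rewrite E2; exact: ler_wpM2r.
have main : expR (B * (Pi a - 2 * e)) <= expR (a * (u * B)) * p.
  exact: (tilting_remainder f1 f2 h1 k2 k3 hp).
have -> : p = expR (- (a * (u * B))) * (expR (a * (u * B)) * p).
  by rewrite mulrA -expRD addNr expR0 mul1r.
apply: le_trans (ler_wpM2l (expR_ge0 _) main).
rewrite -expRD ler_expR.
have au : a * u = a * x + delta / 2.
  by rewrite /u mulrDr; congr (_ + _); field; rewrite gt_eqF.
have : 0 <= B * (rho + Pi a - 2 * e - a * u).
  by rewrite mulr_ge0// au rhoE; exact: tilting_exponent.
move=> le0; rewrite -subr_ge0; apply: (le_trans le0).
by rewrite le_eqVlt; apply/orP; left; apply/eqP; ring.
Qed.

(** The tilt that is optimal at [beta] gains [a * (x - beta)] at the level [x]; half of it is kept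
    as margin. *)
Lemma speed_upper x : beta < x -> exists2 rho, speed Pi beta < rho &
  exists b0, forall b, (b0 <= b)%N ->
    pr Q [set w | x * b%:R <= S b w] <= expR (- (rho * b%:R)).
Proof.
move=> bx; have [a a0 [da ->]] := speedE hPi Pi_zero beta_gt0 beta_lt.
have ab : 0 < a * (x - beta) by rewrite mulr_gt0// subr_gt0.
exists (a * beta - Pi a + a * (x - beta) / 2); first by lra.
by apply: (@upper_deviation a); [exact: ltW|lra].
Qed.

(** The point [z] between [max(y, 0)] and [beta] is positive, hence a slope of [Pi], and its
    exponent [a * z - Pi a] stays below [I(beta)] by at least [a * (beta - z)]. *)
Lemma speed_lower y : y < beta -> exists2 rho, rho < speed Pi beta &
  exists b0, forall b, (b0 <= b)%N ->
    expR (- (rho * b%:R)) <= pr Q [set w | y * b%:R <= S b w].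
Proof.
move=> yb; pose z := (Num.max y 0 + beta) / 2.
have mb : Num.max y 0 < beta by rewrite gt_max yb.
have m0 : 0 <= Num.max y 0 by rewrite le_max lexx orbT.
have my : y <= Num.max y 0 by rewrite le_max lexx.
have z0 : 0 < z by rewrite /z divr_gt0// ltr_wpDl.
have zb : z < beta by rewrite /z ltr_pdivrMr// mulr_natr mulr2n ltrD2r.
have yz : y < z by apply: (le_lt_trans my); rewrite /z ltr_pdivlMr// mulr_natr mulr2n ltrD2l.
have [a a0 da] := derivative_attains hPi Pi_zero beta_lt z0 (ltW zb).
have sg := speed_ge hPi Pi_zero beta_gt0 beta_lt a.
have ab : 0 < a * (beta - z) by rewrite mulr_gt0// subr_gt0.
exists (speed Pi beta - a * (beta - z) / 2); first by lra.
by apply: (lower_deviation a0 da yz); lra.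
Qed.

(** Meant for the short pieces of early windows, where the level may lie below [beta] and some
    exponential decay is enough. *)
Lemma positive_level x : 0 < x -> exists2 rho, 0 < rho &
  exists b0, forall b, (b0 <= b)%N ->
    pr Q [set w | x * b%:R <= S b w] <= expR (- (rho * b%:R)).
Proof.
move=> x0; pose z := Num.min (x / 2) beta.
have z0 : 0 < z by rewrite /z lt_min divr_gt0.
have zb : z <= beta by rewrite /z ge_min lexx orbT.
have zx : z < x by rewrite /z gt_min ltr_pdivrMr// ltr_pMr// ltr1n.
have [a a0 da] := derivative_attains hPi Pi_zero beta_lt z0 zb.
have gx := legendre_gt0 hPi Pi_zero a0 da zx.
exists ((a * x - Pi a) / 2); first by rewrite divr_gt0.
by apply: (@upper_deviation a); [exact: ltW|lra].
Qed.

End deviation_rates.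

Section exponential_moments_mgf.
Context d (Om : measurableType d) (R : realType) (Q : probability Om R).
Variables (p l : nat) (F : l.-tuple (p.-tuple R) -> R) (D : R).
Hypothesis bF : forall x, `|F x| <= D.
Variable Y : 'I_l -> nat -> Om -> p.-tuple R.
Variable Pi : R -> R.

Lemma copies_sum_le b w : `|copies_sum F Y b w| <= D * b%:R.
Proof.
apply: (le_trans (ler_norm_sum _ _ _)).
rewrite mulr_natr -[X in _ *+ X]card_ord -sumr_const.
by apply: ler_sum => i _; exact: bF.
Qed.

(** For constant [gamma] and [n = b + 1] the integral runs over the indices [0, ..., b], and index 0
    contributes 0: exactly the [b] terms of [copies_sum] remain, whence the shifted
    normalization. *)
Lemma exponential_moments_mgf : exponential_moments Q F Y Pi ->
  forall a, (fun b : nat => b.+1%:R^-1 * ln (mgf Q (copies_sum F Y) b a))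
    @ \oo --> Pi a.
Proof.
move=> hexp a.
have pc : piecewise_constant (fun _ : R => a).
  by exists [:: 1]; [exact: itv_partition1|move=> i _; exists a].
have := hexp _ pc.
have -> : \int[lebesgue_measure]_(u in `[0, 1]) Pi a = Pi a.
  by rewrite Rintegral_cst//= lebesgue_measure_itv/= lte_fin ltr01 -EFinB/= subr0 mulr1.
rewrite -cvg_shiftS; apply: cvg_trans; apply: near_eq_cvg; apply: nearW => b /=.
congr (_ * ln _); rewrite /mgf /Rintegral unlock; congr fine.
apply: eq_integral => w _; congr EFin; congr expR.
set G := fun k w => if k == 0%N then 0 else F [tuple Y i (i.+1 * k)%N w | i < l].
have St : \int[lebesgue_measure]_(u in `[0, 1])
    (a * G (Num.truncn (u * b.+1%:R)) w) = b.+1%:R^-1 * (a * \sum_(0 <= k < b.+1) G k w).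
  exact: (Rintegral_step (fun k => G k w) a (ltn0Sn b)).
rewrite [X in _ * X = _](_ : _ = b.+1%:R^-1 * (a * \sum_(0 <= k < b.+1) G k w));
  last exact: St.
rewrite mulrA divff ?mul1r//; congr (_ * _).
by rewrite big_nat_recl// /G eqxx add0r big_mkord.
Qed.

End exponential_moments_mgf.

(** * Increments of the nonconventional sums *)

Section increments.
Context d (Om : measurableType d) (R : realType) (P : probability Om R).
Context d' (Om' : measurableType d') (Q : probability Om' R).
Variables (p l : nat) (F : l.-tuple (p.-tuple R) -> R).
Hypothesis mF : measurable_fun setT F.
Local Notation T := (p.-tuple R).
Variables (X : nat -> Om -> T) (Y : 'I_l -> nat -> Om' -> T).
Hypotheses (mX : forall n, measurable_fun setT (X n))
  (mY : forall j n, measurable_fun setT (Y j n)).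
Hypothesis hstat : stationary P X.
Hypothesis hcopies : forall j, same_law P Q X (Y j).
Hypothesis hindep : independent_processes Q Y.
Variable Fm : \bar int -> \bar int -> set (set Om).
Hypothesis hFm : monotone_sigma_algebras Fm.
Variable kappa1 : R.
Hypothesis kappa1_gt0 : 0 < kappa1.
Hypothesis hmix : forall n : nat,
  (psi P Fm n <= (kappa1^-1 * expR (- kappa1 * n%:R))%:E)%E.
Hypothesis happ : approximable P F Fm X.

Definition incr k b w := Sigma F X (k + b) w - Sigma F X k w.

Local Notation S := (copies_sum F Y).

Lemma measurable_Sigma n : measurable_fun setT (Sigma F X n).
Proof.
apply: measurable_sum => k; apply: (measurableT_comp mF).
apply/measurable_fun_tnthP => j; rewrite (_ : _ \o _ = X (j.+1 * k)%N)//.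
by apply/funext => w /=; rewrite tnth_mktuple.
Qed.

Lemma measurable_incr k b : measurable_fun setT (incr k b).
Proof. by apply: measurable_funB; exact: measurable_Sigma. Qed.

Let mixing_rate (m : nat) := kappa1^-1 * expR (- kappa1 * m%:R).

Let mixing_rate_ge0 m : 0 <= mixing_rate m.
Proof. by rewrite mulr_ge0 ?expR_ge0// invr_ge0 ltW. Qed.

Lemma measurable_ge (x : R) : measurable [set u : R | x <= u].
Proof.
by rewrite (_ : [set _ | _] = `[x, +oo[%classic)//; apply/seteqP; split=> w /=; rewrite in_itv/= andbT.
Qed.

Lemma measurable_lt (x : R) : measurable [set u : R | u < x].
Proof.
by rewrite (_ : [set _ | _] = `]-oo, x[%classic)//; apply/seteqP; split=> w /=; rewrite in_itv/=.
Qed.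

(** One window with gap 0: mixing costs only the constant [C], from the bound on [psi(0)], and [m]
    serves the approximation alone. *)
Lemma incr_upper eps : 0 < eps -> exists (K kap : R) (m0 : nat),
  [/\ 0 <= K, 0 < kap & forall m k b (x : R), (m0 <= m)%N ->
    (l * b + m.*2 <= k)%N ->
    pr P [set w | x * b%:R <= incr k b w] <=
    K * (pr Q [set w | (x - 2 * eps) * b%:R <= S b w] +
         b%:R * expR (- kap * m%:R))].
Proof.
move=> eps0; have [K0 [kap [m0 [K00 kap0 H]]]] := happ eps0.
pose C := (1 + mixing_rate 0) ^+ (l + l * 1).
have C0 : 0 <= C by rewrite exprn_ge0// addr_ge0.
exists (C + l%:R * K0 * (1 + C)), kap, m0; split=> //.
  by rewrite addr_ge0// mulr_ge0// ?addr_ge0// mulr_ge0.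
move=> m k b x m0m kge.
have [Z [Bad [mZ mBad wZ prBad cl]]] := H m m0m.
have := @pr_separated_blocks _ _ _ P _ _ F mF Fm hFm b m 0 1 k (b + m.*2)
  (mixing_rate 0) (K0 * expR (- kap * m%:R)) eps
  (pr Q [set w | (x - 2 * eps) * b%:R <= S b w])
  [set u | x * b%:R <= u] [set u | (x - eps) * b%:R <= u]
  [set u | (x - 2 * eps) * b%:R <= u] X Z Bad mX mZ mBad (measurable_ge _)
  (measurable_ge _) (measurable_ge _) wZ prBad cl (mixing_rate_ge0 0) (hmix 0).
have dist_le (u v z : R) : `|u - v| <= b%:R * eps -> z * b%:R <= u ->
    (z - eps) * b%:R <= v.
  by move=> /ler_normlP[_ uv] zu; lra.
move=> /(_ (fun u v h1 h2 => dist_le u v x h1 h2)).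
have d2 (u v : R) : `|u - v| <= b%:R * eps -> (x - eps) * b%:R <= u ->
    (x - 2 * eps) * b%:R <= v.
  by move=> h1 /(dist_le _ _ _ h1); lra.
move=> /(_ d2); rewrite !addn0 mul0n add0n => /(_ (leqnn _) kge).
have law k' : pr (tuple_prob P l)
    (@coordwise _ _ _ _ (block X b k') l @^-1` (@block_sum _ _ _ F b @^-1`
      [set u | (x - 2 * eps) * b%:R <= u])) <=
    pr Q [set w | (x - 2 * eps) * b%:R <= S b w].
  rewrite (tuple_prob_block_sum mF mX mY hstat hcopies hindep)//.
  exact: measurable_ge.
move=> /(_ law).
rewrite (_ : [set w | forall s, _] = [set w | x * b%:R <= incr k b w]); last first.
  apply/seteqP; split=> w /=; rewrite /incr SigmaB.
    by move=> /(_ ord0); rewrite mul0n addn0.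
  by move=> h s; rewrite ord1 mul0n addn0.
move=> /le_trans; apply.
rewrite expr1 -/C mul1n natrM.
set q := pr Q _; set E := expR _.
have q0 : 0 <= q by exact: pr_ge0.
have E0 : 0 <= E by exact: expR_ge0.
have t0 : 0 <= l%:R * K0 by rewrite mulr_ge0.
have t1 : 0 <= l%:R * K0 * (1 + C) * q by rewrite !mulr_ge0// addr_ge0.
have t2 : 0 <= C * (b%:R * E) by rewrite !mulr_ge0.
rewrite -subr_ge0 (_ : _ - _ = l%:R * K0 * (1 + C) * q + C * (b%:R * E)).
  exact: addr_ge0.
by ring.
Qed.

(** [h = b + 3 m] holds a block, two approximation margins and a mixing gap, each of length [m]; the
    start [(l + 1) N h] keeps the multipliers apart. *)
Lemma incr_lower eps : 0 < eps -> exists (K kap : R) (m0 : nat),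
  [/\ 0 <= K, 0 < kap & forall m N b (y : R) (h := (b + 3 * m)%N),
    (m0 <= m)%N -> (0 < N)%N ->
    pr P [set w | forall s : 'I_N,
      incr (l.+1 * (N * h) + s * h) b w < y * b%:R] <=
    N%:R * (b%:R * (K * expR (- kap * m%:R))) +
    (1 + kappa1^-1 * expR (- kappa1 * m%:R)) ^+ (2 * l * N) *
    (1 - pr Q [set w | (y + 2 * eps) * b%:R <= S b w] +
      b%:R * (K * expR (- kap * m%:R))) ^+ N].
Proof.
move=> eps0; have [K0 [kap [m0 [K00 kap0 H]]]] := happ eps0.
exists (l%:R * K0), kap, m0; split=> //; first by rewrite mulr_ge0.
move=> m N b y h m0m N0.
have [Z [Bad [mZ mBad wZ prBad cl]]] := H m m0m.
have := @pr_separated_blocks _ _ _ P _ _ F mF Fm hFm b m m N (l.+1 * (N * h)) h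
  (mixing_rate m) (K0 * expR (- kap * m%:R)) eps
  (1 - pr Q [set w | (y + 2 * eps) * b%:R <= S b w])
  [set u | u < y * b%:R] [set u | u < (y + eps) * b%:R]
  [set u | u < (y + 2 * eps) * b%:R] X Z Bad mX mZ mBad (measurable_lt _)
  (measurable_lt _) (measurable_lt _) wZ prBad cl (mixing_rate_ge0 m) (hmix m).
have dist_lt (u v z : R) : `|u - v| <= b%:R * eps -> u < z * b%:R ->
    v < (z + eps) * b%:R.
  by move=> /ler_normlP[uv _] zu; lra.
move=> /(_ (fun u v h1 h2 => dist_lt u v y h1 h2)).
have d2 (u v : R) : `|u - v| <= b%:R * eps -> u < (y + eps) * b%:R ->
    v < (y + 2 * eps) * b%:R.
  by move=> h1 /(dist_lt _ _ _ h1); lra.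
move=> /(_ d2).
have hge : (b + m.*2 + m <= h)%N by rewrite /h; lia.
have k0ge : (l * (N.-1 * h + b) + m.*2 + m <= l.+1 * (N * h))%N.
  have bh : (b <= h)%N by rewrite /h; lia.
  have Nh : (N * h = N.-1 * h + h)%N by rewrite -{1}(prednK N0) mulSn addnC.
  rewrite Nh; move: (N.-1 * h)%N => v.
  have : (l * (v + b) <= l * (v + h))%N by rewrite leq_mul2l leq_add2l bh orbT.
  by rewrite mulSn; lia.
move=> /(_ hge k0ge).
have mlev := measurable_level (measurable_copies_sum mF mY) b ((y + 2 * eps) * b%:R).
have law k' : pr (tuple_prob P l)
    (@coordwise _ _ _ _ (block X b k') l @^-1` (@block_sum _ _ _ F b @^-1`
      [set u | u < (y + 2 * eps) * b%:R])) <=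
    1 - pr Q [set w | (y + 2 * eps) * b%:R <= S b w].
  rewrite (tuple_prob_block_sum mF mX mY hstat hcopies hindep)//; last exact: measurable_lt.
  rewrite -prC// (_ : ~` _ = S b @^-1` [set u | u < (y + 2 * eps) * b%:R])//.
  by apply/seteqP; split=> w /=; rewrite ltNge => /negP.
move=> /(_ law).
rewrite (_ : [set w | forall s, _] = [set w | forall s : 'I_N,
      incr (l.+1 * (N * h) + s * h) b w < y * b%:R]); last first.
  by apply/seteqP; split=> w /= H1 s; have := H1 s; rewrite /incr SigmaB.
move=> /le_trans; apply.
rewrite !natrM -/(mixing_rate m).
set q := 1 - pr Q _; set E := expR (- kap * _).
have q0 : 0 <= q by rewrite subr_ge0 pr_le1.
have -> : N%:R * l%:R * b%:R * (K0 * E) = N%:R * (b%:R * (l%:R * K0 * E)) by ring.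
have -> : l%:R * b%:R * (K0 * E) = b%:R * (l%:R * K0 * E) by ring.
rewrite lerD2l; apply: ler_wpM2r.
  by rewrite exprn_ge0// addr_ge0// !mulr_ge0// expR_ge0.
by apply: ler_weXn2l; [rewrite lerDl|nia].
Qed.

End increments.

(** * Exponential bounds and the almost sure limit *)

Section exponential_estimates.
Context (R : realType).

Lemma natr_le_expR (eta : R) (b : nat) : 0 < eta ->
  b%:R <= eta^-1 * expR (eta * b%:R).
Proof.
move=> eta0; rewrite mulrC ler_pdivlMr// mulrC.
by apply: le_trans (expR_ge1Dx _); rewrite lerDr.
Qed.

Lemma natr_expRN_le (kap : R) (b : nat) : 0 < kap ->
  b%:R * expR (- kap * b%:R) <= 2 / kap * expR (- (kap / 2) * b%:R).
Proof.
move=> kap0; have k2 : 0 < kap / 2 by rewrite divr_gt0.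
have := ler_wpM2r (expR_ge0 (- kap * b%:R)) (natr_le_expR b k2).
move/le_trans; apply; rewrite invf_div -[_ * expR _ * expR _]mulrA -expRD.
rewrite (_ : kap / 2 * b%:R + - kap * b%:R = - (kap / 2) * b%:R)//.
by field.
Qed.

Lemma exists_multiple (kap t : R) : 0 < kap -> exists2 L : nat, (0 < L)%N & t <= kap * L%:R.
Proof.
move=> kap0; exists (Num.truncn (t / kap)).+1 => //.
by rewrite mulrC -ler_pdivrMr// ltW// truncnS_gt.
Qed.

Lemma exists_nat_ge (t : R) : exists n0 : nat, forall n, (n0 <= n)%N -> t < n%:R.
Proof.
exists (Num.truncn t).+1 => n h; apply: (lt_le_trans (truncnS_gt t)).
by rewrite ler_nat.
Qed.

Lemma sum_geometric_le (r : R) n : 0 <= r -> r < 1 ->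
  \sum_(i < n) r ^+ i <= (1 - r)^-1.
Proof.
move=> r0 r1; have r10 : 0 < 1 - r by rewrite subr_gt0.
rewrite -[leRHS]mul1r ler_pdivlMr// mulrC -opprB mulNr -subrX1 opprB.
by rewrite gerBl exprn_ge0.
Qed.

Lemma expR_cube (x : R) : 0 <= x -> x ^+ 3 / 6 <= expR x.
Proof.
move=> x0; apply: le_trans (expR_ge1Dxn 2 x0); rewrite lerDr//.
Qed.

Lemma quadratic_le_expR (delta C : R) (b : nat) : 0 < delta ->
  6 * C / delta ^+ 3 <= b%:R -> C * b%:R ^+ 2 <= expR (delta * b%:R).
Proof.
move=> d0 Cb; apply: le_trans (expR_cube _); last by rewrite mulr_ge0// ltW.
rewrite exprMn ler_pdivlMr//.
have d3 : 0 < delta ^+ 3 by rewrite exprn_gt0.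
move: Cb; rewrite ler_pdivrMr// => Cb.
have := ler_wpM2r (sqr_ge0 (b%:R : R)) Cb.
rewrite (_ : 6 * C * _ = C * b%:R ^+ 2 * 6); last by ring.
by move/le_trans; apply; rewrite le_eqVlt; apply/orP; left; apply/eqP; ring.
Qed.

End exponential_estimates.

Section borel_cantelli_exponential.
Context d (Om : measurableType d) (R : realType) (P : probability Om R).

Lemma borel_cantelli_expR (A : nat -> set Om) (C eta : R) b0 : 0 < eta ->
  (forall b, measurable (A b)) ->
  (forall b, (b0 <= b)%N -> pr P (A b) <= C * expR (- eta * b%:R)) ->
  {ae P, forall w, exists b1, forall b, (b1 <= b)%N -> ~ A b w}.
Proof.
move=> eta0 mA HA.
pose r := expR (- eta).
have r0 : 0 <= r by exact: expR_ge0.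
have r1 : r < 1 by rewrite /r expR_lt1 oppr_lt0.
pose C' := `|C|.
have C'0 : 0 <= C' by exact: normr_ge0.
pose A' b := A (b0 + b)%N.
have mA' b : measurable (A' b) by exact: mA.
have HA' b : pr P (A' b) <= C' * r ^+ b.
  apply: (le_trans (HA _ (leq_addr _ _))).
  apply: (@le_trans _ _ (C' * expR (- eta * (b0 + b)%:R))).
    by rewrite ler_wpM2r ?expR_ge0// ler_norm.
  rewrite ler_wpM2l// /r -expRM_natr ler_expR -subr_ge0 natrD.
  rewrite (_ : _ - _ = eta * b0%:R); last by ring.
  by rewrite mulr_ge0// ltW.
have fin : (\sum_(n <oo) P (A' n) < +oo)%E.
  apply: (@le_lt_trans _ _ (C' * (1 - r)^-1)%:E); last exact: ltry.
  apply: lime_le; first by apply: is_cvg_nneseries.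
  apply: nearW => n; rewrite big_mkord.
  apply: (@le_trans _ _ (\sum_(i < n) (C' * r ^+ i)%:E)%E).
    by apply: lee_sum => i _; rewrite prE// lee_fin.
  by rewrite sumEFin lee_fin -mulr_sumr ler_wpM2l// sum_geometric_le.
have := lim_sup_set_cvg0 mA' fin => lim0.
exists (lim_sup_set A'); split=> //.
  apply: bigcap_measurableType => n _; exact: bigcup_measurable.
move=> w /= H n _; apply: contrapT => nA; apply: H; exists (b0 + n)%N => b nb Ab.
apply: nA; exists (b - b0)%N => /=; first by lia.
by rewrite /A' subnKC//; lia.
Qed.

End borel_cantelli_exponential.

Section exceedances.
Context d (Om : measurableType d) (R : realType) (P : probability Om R).
Variable I : nat -> nat -> Om -> R.
Hypothesis mI : forall k b, measurable_fun setT (I k b).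

Lemma measurable_exceed x k b : measurable [set w | x * b%:R <= I k b w].
Proof.
rewrite (_ : [set _ | _] = I k b @^-1` `[x * b%:R, +oo[%classic).
  exact: (measurable_preimage (mI k b)).
by apply/seteqP; split=> w /=; rewrite in_itv/= andbT.
Qed.

Lemma measurable_some_exceed x n (f : nat -> nat) b :
  measurable [set w | exists2 i, (i < n)%N & x * b%:R <= I (f i) b w].
Proof.
rewrite (_ : [set _ | _] = \big[setU/set0]_(i < n) [set w | x * b%:R <= I (f i) b w]).
  by apply: bigsetU_measurable => i _; exact: measurable_exceed.
rewrite -(bigcup_mkord n (fun i => [set w | x * b%:R <= I (f i) b w])).
by apply/seteqP; split=> w [i]; exists i.
Qed.

Lemma pr_some_exceed x n (f : nat -> nat) b (c : R) :
  (forall i, pr P [set w | x * b%:R <= I (f i) b w] <= c) ->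
  pr P [set w | exists2 i, (i < n)%N & x * b%:R <= I (f i) b w] <= n%:R * c.
Proof.
move=> Hc.
have := @pr_bigcup _ _ _ P n (fun i => [set w | x * b%:R <= I (f i) b w])
  [set w | exists2 i, (i < n)%N & x * b%:R <= I (f i) b w]
  (fun i _ => measurable_exceed _ _ _) (measurable_some_exceed _ _ _ _) (fun w Hw => Hw).
move/le_trans; apply; rewrite (_ : n%:R * c = \sum_(i < n) c).
  by apply: ler_sum => i _; exact: Hc.
by rewrite sumr_const card_ord mulr_natl.
Qed.

End exceedances.

(** * Exceedances in windows with a small start *)

Section early_exceedances.
Context d (Om : measurableType d) (R : realType) (P : probability Om R).
Variables (l : nat) (I : nat -> nat -> Om -> R) (D : R) (tail : R -> nat -> R).
Hypothesis mI : forall k b, measurable_fun setT (I k b).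
Hypothesis ID : forall k a b w, I k (a + b) w = I k a w + I (k + a) b w.

Lemma increment_split k a q b w : (q * a <= b)%N ->
  I k b w = \sum_(i < q) I (k + i * a) a w + I (k + q * a) (b - q * a) w.
Proof.
elim: q b => [|q IH] b qab.
  by rewrite big_ord0 add0r mul0n addn0 subn0.
rewrite (IH b); last by apply: leq_trans qab; rewrite mulSn leq_addl.
rewrite big_ord_recr/= -addrA; congr (_ + _).
have -> : (b - q * a = a + (b - q.+1 * a))%N by rewrite mulSn in qab *; lia.
by rewrite ID -addnA -mulSnr.
Qed.

Lemma sum_prefix_le (n q : nat) (c : R) : 0 <= c ->
  \sum_(i < q) (if (i < n)%N then c else 0) <= n%:R * c.
Proof.
move=> c0; suff -> : \sum_(i < q) (if (i < n)%N then c else 0) = (minn q n)%:R * c.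
  by rewrite ler_wpM2r// ler_nat geq_minr.
elim: q => [|q IH]; first by rewrite big_ord0 min0n mul0r.
rewrite big_ord_recr/= IH; case: (ltnP q n) => qn.
  by rewrite (minn_idPl qn) -natr1 mulrDl mul1r.
by rewrite addr0 (minn_idPr (leqW qn)).
Qed.

Hypotheses (D0 : 0 <= D) (bI : forall k b w, `|I k b w| <= D * b%:R).
Hypothesis upper : forall eps : R, 0 < eps -> exists (K kap : R) (m0 : nat),
  [/\ 0 <= K, 0 < kap & forall m k b (x : R), (m0 <= m)%N ->
    (l * b + m.*2 <= k)%N ->
    pr P [set w | x * b%:R <= I k b w] <=
    K * (tail (x - 2 * eps) b + b%:R * expR (- kap * m%:R))].
Hypothesis tail_pos : forall x, 0 < x -> exists2 rho, 0 < rho &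
  exists b0, forall b, (b0 <= b)%N -> tail x b <= expR (- (rho * b%:R)).

(* The block is cut into q pieces: the first l + 2 ones are bounded trivially, *)
(* and the others start late enough for the upper bound to apply to them.     *)
Lemma exceed_any_start x : 0 < x -> exists (C eta : R) (b0 : nat),
  [/\ 0 <= C, 0 < eta & forall k b, (b0 <= b)%N ->
    pr P [set w | x * b%:R <= I k b w] <= C * expR (- eta * b%:R)].
Proof.
move=> x0; have x8 : 0 < x / 8 by rewrite divr_gt0.
have [K [kap [m0 [K0 kap0 H]]]] := upper x8.
have x4 : 0 < x / 4 by rewrite divr_gt0.
have [rho rho0 [b1 Hb1]] := tail_pos x4.
(* The [l + 2] pieces bounded trivially contribute at most [x * b / 4], and for large [b] so does
   the remainder of length below [q]; the other pieces have [x * b / 2] to share. *)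
have [q q0 hq] : exists2 q : nat, (0 < q)%N & 4 * D * (l + 2)%:R <= x * q%:R.
  exact: exists_multiple.
have qR : 0 < q%:R :> R by rewrite ltr0n.
have [b2 Hb2] := exists_nat_ge (4 * D * q%:R / x).
pose eta := Num.min rho (kap / 2).
have eta0 : 0 < eta by rewrite /eta lt_min rho0 divr_gt0.
have eta_rho : eta <= rho by rewrite /eta ge_min lexx.
have eta_kap : eta <= kap / 2 by rewrite /eta ge_min lexx orbT.
pose C1 := K * (1 + 2 / kap).
have C10 : 0 <= C1 by rewrite mulr_ge0// addr_ge0// divr_ge0// ltW.
exists (q%:R * (C1 * expR eta)), (eta / q%:R), (maxn b2 (q * maxn m0 b1)).
split; [by do 2 (apply: mulr_ge0 => //); exact: expR_ge0|by rewrite divr_gt0|].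
move=> k b; rewrite geq_max => /andP[bb2 bq].
pose a := (b %/ q)%N.
have am : (maxn m0 b1 <= a)%N by rewrite /a leq_divRL// mulnC.
have am0 : (m0 <= a)%N by apply: leq_trans am; exact: leq_maxl.
have ab1 : (b1 <= a)%N by apply: leq_trans am; exact: leq_maxr.
have aq : (q * a <= b)%N by rewrite mulnC leq_trunc_div.
have bmod : (b - q * a < q)%N by rewrite {1}(divn_eq b q) mulnC addKn ltn_mod.
have aqR : q%:R * a%:R <= b%:R :> R by rewrite -natrM ler_nat.
have bmodR : (b - q * a)%:R <= q%:R :> R by rewrite ler_nat ltnW.
have piece i : (l + 2 <= i)%N ->
    pr P [set w | x / 2 * a%:R <= I (k + i * a) a w] <= C1 * expR (- eta * a%:R).
  move=> li; have := H a (k + i * a)%N a (x / 2) am0.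
  (* With [m = a] the required start is [l * a + 2 * a], reached from piece [l + 2] on whatever [k]
     is. *)
  have -> : x / 2 - 2 * (x / 8) = x / 4 by field.
  have : (l * a + a.*2 <= k + i * a)%N.
    by rewrite (leq_trans _ (leq_addl _ _))// -muln2 mulnC -mulnDr mulnC leq_mul2r li orbT.
  move=> hla /(_ hla) /le_trans; apply.
  rewrite /C1 -mulrA ler_wpM2l// mulrDl mul1r; apply: lerD.
    apply: (le_trans (Hb1 _ ab1)); rewrite ler_expR mulNr lerN2 ler_wpM2r//.
  apply: (le_trans (natr_expRN_le a kap0)); rewrite ler_wpM2l ?divr_ge0 ?(ltW kap0)//.
  by rewrite ler_expR !mulNr lerN2 ler_wpM2r.
pose A i := if (l + 2 <= i)%N then [set w | x / 2 * a%:R <= I (k + i * a) a w] else set0.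
have mA i : measurable (A i).
  by rewrite /A; case: ifP => // _; exact: measurable_exceed.
have prA i : pr P (A i) <= C1 * expR (- eta * a%:R).
  rewrite /A; case: ifP => [|_]; first exact: piece.
  by rewrite /pr measure0 mulr_ge0 ?expR_ge0.
have BA w : x * b%:R <= I k b w -> exists2 i, (i < q)%N & A i w.
  move=> xI; apply: contrapT => nA.
  have small i : (i < q)%N -> (l + 2 <= i)%N -> I (k + i * a) a w < x / 2 * a%:R.
    move=> iq li; rewrite ltNge; apply/negP => Hi; apply: nA; exists i => //.
    by rewrite /A li.
  move: xI; apply/negP; rewrite -ltNge (increment_split k w aq).
  have s1 : \sum_(i < q) I (k + i * a) a w <=
      \sum_(i < q) (x / 2 * a%:R) + \sum_(i < q) (if (i < l + 2)%N then D * a%:R else 0).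
    rewrite -big_split/=; apply: ler_sum => i _; case: ltnP => li.
      rewrite -[leLHS]add0r; apply: lerD.
        by rewrite mulr_ge0// divr_ge0// ltW.
      exact: le_trans (ler_norm _) (bI _ _ _).
    by rewrite addr0 ltW// small.
  have s2 : \sum_(i < q) (if (i < l + 2)%N then D * a%:R else 0) <= (l + 2)%:R * (D * a%:R).
    by apply: sum_prefix_le; rewrite mulr_ge0.
  have s3 : \sum_(i < q) (x / 2 * a%:R) = q%:R * (x / 2 * a%:R).
    by rewrite sumr_const card_ord mulr_natl.
  have s4 : I (k + q * a) (b - q * a) w <= D * q%:R.
    apply: (le_trans (ler_norm _)); apply: (le_trans (bI _ _ _)); exact: ler_wpM2l.
  have s5 : 4 * D * q%:R < x * b%:R.
    by rewrite [ltRHS]mulrC -ltr_pdivrMr//; exact: Hb2.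
  have s6 := ler_wpM2r (ler0n R a) hq.
  have s7 := ler_wpM2l (ltW x0) aqR.
  move: s1 s2 s3 s4 s5 s6 s7.
  move: (\sum_(i < q) _) => u1; move: (\sum_(i < q) _) => u2; move: (\sum_(i < q) _) => u3.
  move: (I _ _ _) => u4; move: b%:R a%:R q%:R (l + 2)%:R => B1 A1 Q1 L1.
  lra.
have := pr_bigcup P (fun i _ => mA i) (measurable_exceed mI x k b) BA.
move/le_trans; apply.
apply: (@le_trans _ _ (\sum_(i < q) (C1 * expR (- eta * a%:R)))).
  by apply: ler_sum => i _; exact: prA.
rewrite sumr_const card_ord -[_ *+ q]mulr_natl -!mulrA ler_wpM2l// ler_wpM2l//.
rewrite -expRD; apply: ler_wpM2l; first by rewrite addr_ge0// divr_ge0// ltW.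
rewrite ler_expR.
have b_lt : b%:R <= (a%:R + 1) * q%:R :> R.
  by rewrite natr1 -natrM ler_nat; exact: ltnW (ltn_ceil b q0).
have : eta / q%:R * b%:R <= eta * (a%:R + 1).
  by rewrite -mulrA ler_wpM2l ?(ltW eta0)// mulrC ler_pdivrMr.
by rewrite mulrDr mulr1 !mulNr => h; rewrite lerNl opprB lerBlDr.
Qed.

(** The number of early starts is only linear in [b], so any positive rate survives the union
    bound. *)
Lemma exceed_early x n : 0 < x -> exists (C eta : R) (b0 : nat),
  0 < eta /\ forall b, (b0 <= b)%N ->
    pr P [set w | exists2 k, (k < n * b)%N & x * b%:R <= I k b w] <=
    C * expR (- eta * b%:R).
Proof.
move=> x0; have [C [eta [b0 [C0 eta0 H]]]] := exceed_any_start x0.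
exists (n%:R * C * (2 / eta)), (eta / 2), b0; split; first by rewrite divr_gt0.
move=> b bb0; apply: (le_trans (pr_some_exceed mI (n * b) (f := id) (fun i => H i b bb0))).
rewrite natrM -!mulrA ler_wpM2l// [leLHS]mulrCA ler_wpM2l// mulrA.
exact: natr_expRN_le.
Qed.

End early_exceedances.

(** * Exceedances in windows with a late start *)

Section late_exceedances.
Context d (Om : measurableType d) (R : realType) (P : probability Om R).
Variables (l : nat) (I : nat -> nat -> Om -> R) (tail : R -> nat -> R).
Hypothesis mI : forall k b, measurable_fun setT (I k b).
Hypothesis upper : forall eps : R, 0 < eps -> exists (K kap : R) (m0 : nat),
  [/\ 0 <= K, 0 < kap & forall m k b (x : R), (m0 <= m)%N ->
    (l * b + m.*2 <= k)%N ->
    pr P [set w | x * b%:R <= I k b w] <=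
    K * (tail (x - 2 * eps) b + b%:R * expR (- kap * m%:R))].
Variables (beta lam : R).
Hypothesis lam_gt0 : 0 < lam.
Hypothesis speed_up : forall x, beta < x -> exists2 rho, lam < rho &
  exists b0, forall b, (b0 <= b)%N -> tail x b <= expR (- (rho * b%:R)).

(** With [b + 1] in the exponent the range covers every [n] whose block length is [b]. *)
Definition last_start b : nat := (Num.truncn (expR (lam * b.+1%:R))).+1.

Lemma last_start_le b : (last_start b)%:R <= 2 * expR (lam * b.+1%:R).
Proof.
have e1 : 1 <= expR (lam * b.+1%:R).
  by rewrite -expR0 ler_expR mulr_ge0// ltW.
rewrite /last_start -natr1.
have : (Num.truncn (expR (lam * b.+1%:R)))%:R <= expR (lam * b.+1%:R).
  by rewrite truncn_le expR_ge0.
lra.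
Qed.

Lemma exceed_late x : beta < x -> exists (n : nat) (C eta : R) (b0 : nat),
  0 < eta /\ forall b, (b0 <= b)%N ->
    pr P [set w | exists2 i, (i < last_start b)%N & x * b%:R <= I (n * b + i) b w] <=
    C * expR (- eta * b%:R).
Proof.
move=> bx; pose eps := (x - beta) / 4.
have eps0 : 0 < eps by rewrite divr_gt0// subr_gt0.
have [K [kap [m0 [K0 kap0 H]]]] := upper eps0.
have bx1 : beta < x - 2 * eps by rewrite /eps; lra.
have [rho rhol [b1 Hb1]] := speed_up bx1.
(* With [m = L b] the approximation error decays at rate [rho + 1]; the unit pays for its factor
   [b]. The starts then begin at [l b + 2 m = (l + 2 L) b]. *)
have [L L0 hL] := exists_multiple (rho + 1) kap0.
exists (l + 2 * L)%N, (4 * K * expR lam), (rho - lam), (maxn b1 m0).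
split; first by rewrite subr_gt0.
move=> b; rewrite geq_max => /andP[bb1 bm0].
have one i : pr P [set w | x * b%:R <= I ((l + 2 * L) * b + i) b w] <=
    2 * K * expR (- (rho * b%:R)).
  have m0L : (m0 <= L * b)%N by apply: (leq_trans bm0); rewrite leq_pmull.
  have kge : (l * b + (L * b).*2 <= (l + 2 * L) * b + i)%N by lia.
  apply: (le_trans (H _ _ _ _ m0L kge)).
  rewrite [2 * K]mulrC -mulrA ler_wpM2l// [leRHS]mulr_natl mulr2n.
  apply: lerD; first exact: Hb1.
  have := natr_le_expR b (@ltr01 R); rewrite invr1 !mul1r => be.
  apply: (le_trans (ler_wpM2r (expR_ge0 _) be)); rewrite -expRD ler_expR natrM.
  have := ler_wpM2r (ler0n R b) hL; lra.
have := pr_some_exceed mI (last_start b) (f := fun i => ((l + 2 * L) * b + i)%N) one.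
move/le_trans; apply.
have K20 : 0 <= 2 * K * expR (- (rho * b%:R)) by rewrite mulr_ge0 ?expR_ge0// mulr_ge0.
apply: (le_trans (ler_wpM2r K20 (last_start_le b))).
rewrite (_ : expR (lam * b.+1%:R) = expR lam * expR (lam * b%:R)); last first.
  by rewrite -expRD -natr1; congr expR; ring.
rewrite (_ : - (rho - lam) * b%:R = lam * b%:R + - (rho * b%:R)); last by ring.
rewrite expRD le_eqVlt; apply/orP; left; apply/eqP; ring.
Qed.

End late_exceedances.

(** * All sums small on separated windows *)

Section joint_non_exceedance.
Context d (Om : measurableType d) (R : realType) (P : probability Om R).
Variables (l : nat) (I : nat -> nat -> Om -> R) (tail : R -> nat -> R).
Hypothesis mI : forall k b, measurable_fun setT (I k b).
Variables (beta lam : R).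

(* N windows spaced by h, the first one starting at (l + 1) N h, end before    *)
(* (l + 2) N h <= exp (lam b).                                                *)
Definition windows (h b : nat) : nat :=
  Num.truncn (expR (lam * b%:R) / ((l + 2) * h)%:R).

Lemma windows_le h b : ((l + 2) * (windows h b * h))%:R <= expR (lam * b%:R).
Proof.
have [->|h0] := posnP h; first by rewrite muln0 muln0 expR_ge0.
have lh : 0 < ((l + 2) * h)%:R :> R by rewrite ltr0n muln_gt0 h0 addn_gt0 orbT.
rewrite mulnCA natrM -ler_pdivlMr// /windows truncn_le divr_ge0 ?expR_ge0// ltW.
Qed.

Definition all_below (n : nat) (y : R) b : set Om :=
  [set w | forall s : 'I_(windows (n * b) b),
     I (l.+1 * (windows (n * b) b * (n * b)) + s * (n * b)) b w < y * b%:R].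

Lemma measurable_all_below n y b : measurable (all_below n y b).
Proof.
rewrite (_ : all_below _ _ _ = \bigcap_(s in [set: 'I_(windows (n * b) b)])
   ~` [set w | y * b%:R <= I (l.+1 * (windows (n * b) b * (n * b)) + s * (n * b)) b w]).
  by apply: fin_bigcap_measurable => // s _; apply: measurableC; exact: measurable_exceed.
apply/seteqP; split=> w /= H s => [_|].
  by rewrite /= leNgt (H s).
by rewrite ltNge; apply/negP; exact: (H s Logic.I).
Qed.

Hypothesis lam_gt0 : 0 < lam.
Hypothesis tail1 : forall x b, tail x b <= 1.
Variable kappa1 : R.
Hypothesis kappa1_gt0 : 0 < kappa1.
Hypothesis lower : forall eps : R, 0 < eps -> exists (K kap : R) (m0 : nat),
  [/\ 0 <= K, 0 < kap & forall m N b (y : R) (h := (b + 3 * m)%N),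
    (m0 <= m)%N -> (0 < N)%N ->
    pr P [set w | forall s : 'I_N,
      I (l.+1 * (N * h) + s * h) b w < y * b%:R] <=
    N%:R * (b%:R * (K * expR (- kap * m%:R))) +
    (1 + kappa1^-1 * expR (- kappa1 * m%:R)) ^+ (2 * l * N) *
    (1 - tail (y + 2 * eps) b + b%:R * (K * expR (- kap * m%:R))) ^+ N].
Hypothesis speed_low : forall y, y < beta -> exists2 rho, rho < lam &
  exists b0, forall b, (b0 <= b)%N -> expR (- (rho * b%:R)) <= tail y b.

(** Half of the success probability [p = expR (- rho b)] is given up to the approximation error. As
    [rho < lam], [N * p / 2 >= b] for large [b], so that [(1 - p / 2) ^ N <= expR (- b)]. *)
Lemma pr_all_below y : y < beta -> exists (n : nat) (C eta : R) (b0 : nat),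
  [/\ (0 < n)%N, 0 < eta & forall b, (b0 <= b)%N ->
    pr P (all_below n y b) <= C * expR (- eta * b%:R)].
Proof.
move=> yb; pose eps := (beta - y) / 4.
have eps0 : 0 < eps by rewrite divr_gt0// subr_gt0.
have [K [kap [m0 [K0 kap0 H]]]] := lower eps0.
have yb1 : y + 2 * eps < beta by rewrite /eps; lra.
have [rho rhol [b1 Hb1]] := speed_low yb1.
(* [lam] pays for the number of windows, one unit for the factor [b], and one unit is left as
   decay. *)
have [L1 L10 hL1] := exists_multiple (lam + 2) kap0.
(* The mixing rate over the gap is at most of order [1 / N], so its power [2 l N] stays bounded. *)
have [L2 L20 hL2] := exists_multiple lam kappa1_gt0.
pose L := (L1 + L2)%N.
have hL1' : lam + 2 <= kap * L%:R.
  by apply: (le_trans hL1); rewrite ler_wpM2l ?ler_nat ?leq_addr// ltW.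
have hL2' : lam <= kappa1 * L%:R.
  by apply: (le_trans hL2); rewrite ler_wpM2l ?ler_nat ?leq_addl// ltW.
pose n := (1 + 3 * L)%N.
pose C0 : R := ((l + 2) * n)%:R.
have C00 : 0 < C0 by rewrite ltr0n muln_gt0 addn_gt0 orbT.
pose delta := lam - rho.
have delta0 : 0 < delta by rewrite subr_gt0.
(* [b2] puts the approximation error below [p / 2]; [b3] gives [4 b <= z * p] and [b4] gives
   [2 <= z], where [z] is the number of windows before truncation. *)
have [b2 Hb2] := exists_nat_ge (2 * K).
have [b3 Hb3] := exists_nat_ge (6 * (4 * C0) / delta ^+ 3).
have [b4 Hb4] := exists_nat_ge (6 * (2 * C0) / lam ^+ 3).
exists n, (K + expR (2 * l%:R / kappa1)), 1, (maxn (maxn (maxn b1 b2) (maxn b3 b4)) (maxn m0 1)).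
split=> // b; rewrite !geq_max => /andP[/andP[/andP[bb1 bb2] /andP[bb3 bb4]] /andP[bm0 bpos]].
have bR : 1 <= b%:R :> R by rewrite ler1n.
have bR0 : 0 < b%:R :> R by rewrite ltr0n.
pose m := (L * b)%N.
have m0m : (m0 <= m)%N.
  by apply: (leq_trans bm0); rewrite leq_pmull// addn_gt0 L10.
have hE : (b + 3 * m = n * b)%N by rewrite /n /m mulnDl mul1n mulnA.
set N := windows (n * b) b.
pose z := expR (lam * b%:R) / (C0 * b%:R).
have NE : N = Num.truncn z by rewrite /N /windows /z mulnA natrM.
have z2 : 2 <= z.
  rewrite /z ler_pdivlMr ?mulr_gt0//.
  have := quadratic_le_expR lam_gt0 (ltW (Hb4 b bb4)); apply: le_trans.
  by rewrite mulrA ler_wpM2l ?mulr_ge0 ?(ltW C00)// expr2 ler_peMl// ltW.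
have z0 : 0 <= z by apply: le_trans z2.
have Nlt : z < N%:R + 1 by rewrite NE natr1 truncnS_gt.
have Nle : N%:R <= z by rewrite NE truncn_le.
have N0 : (0 < N)%N by rewrite NE truncn_gt0; apply: le_trans z2; rewrite ler1n.
have zle : z <= expR (lam * b%:R).
  rewrite /z ler_pdivrMr ?mulr_gt0// ler_peMr ?expR_ge0//.
  by rewrite mulr_ege1// ler1n muln_gt0 addn_gt0 orbT.
have := H m N b y m0m N0; rewrite hE => /le_trans; apply.
set E := expR (- kap * _); set c := kappa1^-1 * _.
have E0 : 0 <= E by exact: expR_ge0.
have bexp : b%:R <= expR b%:R :> R.
  by apply: le_trans (expR_ge1Dx _); rewrite lerDr.
have EE : E <= expR (- ((lam + 2) * b%:R)).
  rewrite /E ler_expR /m natrM mulrA !mulNr lerN2; exact: ler_wpM2r.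
have bKE : b%:R * (K * E) <= K * expR (- ((lam + 1) * b%:R)).
  rewrite mulrCA ler_wpM2l//; apply: (le_trans (ler_pM _ _ bexp EE)) => //.
  by rewrite -expRD ler_expR le_eqVlt; apply/orP; left; apply/eqP; ring.
have T1 : N%:R * (b%:R * (K * E)) <= K * expR (- b%:R).
  have bKE0 : 0 <= b%:R * (K * E) by rewrite !mulr_ge0.
  apply: (le_trans (ler_pM _ _ (le_trans Nle zle) bKE)) => //.
  rewrite mulrCA -expRD ler_wpM2l// ler_expR le_eqVlt; apply/orP; left.
  by apply/eqP; ring.
have c0 : 0 <= c by rewrite mulr_ge0 ?expR_ge0// invr_ge0 ltW.
have T2 : (1 + c) ^+ (2 * l * N) <= expR (2 * l%:R / kappa1).
  apply: (@le_trans _ _ (expR c ^+ (2 * l * N))).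
    by apply: lerXn2r; rewrite ?nnegrE ?addr_ge0 ?expR_ge0// expR_ge1Dx.
  rewrite -expRM_natr ler_expR.
  rewrite /c.
  have : expR (- kappa1 * m%:R) * N%:R <= 1.
    apply: (le_trans (ler_wpM2l (expR_ge0 _) (le_trans Nle zle))).
    rewrite -expRD -[leRHS]expR0 ler_expR /m natrM.
    by have := ler_wpM2r (ler0n R b) hL2'; lra.
  move=> eN; rewrite (natrM _ (2 * l) N) (natrM _ 2 l).
  have k10 : 0 <= 2 * l%:R / kappa1 by rewrite divr_ge0 ?mulr_ge0// ltW.
  have := ler_wpM2l k10 eN; rewrite mulr1; apply: le_trans.
  by rewrite le_eqVlt; apply/orP; left; apply/eqP; ring.
set p := expR (- (rho * b%:R)).
have p0 : 0 <= p by exact: expR_ge0.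
have bK2 : b%:R * (K * E) <= p / 2.
  apply: (le_trans bKE); rewrite ler_pdivlMr//.
  have e1 : expR (- ((lam + 1) * b%:R)) <= p * expR (- b%:R).
    rewrite /p -expRD ler_expR.
    by have := ler_wpM2r (ler0n R b) (ltW rhol); lra.
  have K2 : 2 * K * expR (- b%:R) <= 1.
    rewrite expRN ler_pdivrMr ?expR_gt0// mul1r.
    by apply: le_trans bexp; exact: ltW (Hb2 b bb2).
  have := ler_wpM2l K0 e1; have := ler_wpM2l p0 K2.
  rewrite mulr1; move: (expR _) (expR _) => e2 e3.
  lra.
have T3 : (1 - tail (y + 2 * eps) b + b%:R * (K * E)) ^+ N <= expR (- b%:R).
  apply: (@le_trans _ _ (expR (- (p / 2)) ^+ N)).
    apply: lerXn2r; rewrite ?nnegrE ?expR_ge0//.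
      by rewrite addr_ge0 ?subr_ge0// !mulr_ge0.
    apply: le_trans (expR_ge1Dx _).
    have := Hb1 b bb1; rewrite -/p; lra.
  rewrite -expRM_natr ler_expR mulNr lerN2.
  have zN : z / 2 <= N%:R by lra.
  have p20 : 0 <= p / 2 by rewrite divr_ge0.
  apply: le_trans (ler_wpM2l p20 zN).
  have zp : z * p = expR (delta * b%:R) / (C0 * b%:R).
    by rewrite /z /p mulrAC -expRD /delta; congr (expR _ / _); ring.
  have : 4 * b%:R <= z * p.
    rewrite zp ler_pdivlMr ?mulr_gt0//.
    have := quadratic_le_expR delta0 (ltW (Hb3 b bb3)); apply: le_trans.
    by rewrite le_eqVlt; apply/orP; left; apply/eqP; ring.
  lra.
rewrite mulN1r [leRHS]mulrDl; apply: lerD => //.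
apply: ler_pM => //.
  by rewrite exprn_ge0// addr_ge0.
by rewrite exprn_ge0// addr_ge0 ?subr_ge0// !mulr_ge0.
Qed.

End joint_non_exceedance.

Section logarithmic_blocks.
Context (R : realType) (lam : R).
Hypothesis lam_gt0 : 0 < lam.

Lemma bc_bounds n : (0 < n)%N ->
  expR (lam * (bc lam^-1 n)%:R) <= n%:R < expR (lam * (bc lam^-1 n).+1%:R).
Proof.
move=> n0; have n1 : 1 <= n%:R :> R by rewrite ler1n.
have x0 : 0 <= lam^-1 * ln n%:R by rewrite mulr_ge0 ?invr_ge0 ?(ltW lam_gt0)// ln_ge0.
have /andP[h1 h2] := truncn_itv x0.
have E : n%:R = expR (ln n%:R) :> R by rewrite lnK// posrE ltr0n.
rewrite E ler_expR ltr_expR; apply/andP; split.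
  by rewrite mulrC -ler_pdivlMr// mulrC.
by rewrite [ltRHS]mulrC -ltr_pdivrMr// mulrC.
Qed.

Lemma bc_large b0 : exists n0, forall n, (n0 <= n)%N -> (b0 <= bc lam^-1 n)%N.
Proof.
have [n0 H] := exists_nat_ge (expR (lam * b0%:R)).
exists n0.+1 => n nn; have nR := H n (ltnW nn).
have n0' : (0 < n)%N by exact: leq_ltn_trans nn.
have x0 : 0 <= lam^-1 * ln n%:R.
  by rewrite mulr_ge0 ?invr_ge0 ?(ltW lam_gt0)// ln_ge0// ler1n.
rewrite /bc truncn_ge_nat// mulrC ler_pdivlMr// mulrC.
by rewrite -ler_expR lnK ?posrE ?ltr0n// ltW.
Qed.

Lemma bcu1 c n : bcu c n (1 : R) = bc c n.
Proof. by rewrite /bcu mul1r natrK. Qed.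

End logarithmic_blocks.

(** * Almost sure convergence of the maximum *)

Section erdos_renyi.
Context d (Om : measurableType d) (R : realType) (P : probability Om R).
Variables (p l : nat) (F : l.-tuple (p.-tuple R) -> R).
Variables (X : nat -> Om -> p.-tuple R) (beta lam : R).
Hypothesis lam_gt0 : 0 < lam.
Local Notation I := (incr F X).
Hypothesis exceed_late' : forall x, beta < x ->
  exists (n : nat) (C eta : R) (b0 : nat),
  0 < eta /\ forall b, (b0 <= b)%N ->
    pr P [set w | exists2 i, (i < last_start lam b)%N & x * b%:R <= I (n * b + i) b w] <=
    C * expR (- eta * b%:R).
Hypothesis exceed_early' : forall x n, beta < x -> exists (C eta : R) (b0 : nat),
  0 < eta /\ forall b, (b0 <= b)%N ->
    pr P [set w | exists2 k, (k < n * b)%N & x * b%:R <= I k b w] <=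
    C * expR (- eta * b%:R).
Hypothesis pr_all_below' : forall y, y < beta ->
  exists (n : nat) (C eta : R) (b0 : nat),
  [/\ (0 < n)%N, 0 < eta & forall b, (b0 <= b)%N ->
    pr P (all_below l I lam n y b) <= C * expR (- eta * b%:R)].
Hypothesis mI : forall k b, measurable_fun setT (I k b).

Lemma VE c k n w : V F X c k n 1 w = I k (bc c n) w / (bc c n)%:R.
Proof. by rewrite /V bcu1. Qed.

Lemma maxV_le c n w z : (0 < bc c n)%N ->
  (forall k, (k <= n - bc c n)%N -> I k (bc c n) w < z * (bc c n)%:R) ->
  maxV F X c n w <= z.
Proof.
move=> b0 H; have VZ k : (k <= n - bc c n)%N -> V F X c k n 1 w <= z.
  by move=> kn; rewrite VE ler_pdivrMr ?ltr0n// ltW// H.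
rewrite /maxV big_mkord; elim/big_ind: _ => [|u v uz vz|i _].
- exact: VZ.
- by rewrite ge_max uz.
- by apply: VZ; rewrite -ltnS.
Qed.

Lemma maxV_ge c n w y k : (0 < bc c n)%N -> (k <= n - bc c n)%N ->
  y * (bc c n)%:R <= I k (bc c n) w -> y <= maxV F X c n w.
Proof.
move=> b0 kn H; rewrite /maxV big_mkord.
have kn' : (k < (n - bc c n).+1)%N by rewrite ltnS.
apply: (@le_trans _ _ (V F X c k n 1 w)); first by rewrite VE ler_pdivlMr ?ltr0n.
exact: (le_bigmax _ (fun i : 'I_(n - bc c n).+1 => V F X c i n 1 w) (Ordinal kn')).
Qed.

Lemma maxV_near e : 0 < e -> {ae P, forall w, exists n0, forall n, (n0 <= n)%N ->
  beta - e <= maxV F X lam^-1 n w <= beta + e}.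
Proof.
move=> e0.
have bx : beta < beta + e by rewrite ltrDl.
have yb : beta - e < beta by rewrite gtrBl.
have [n1 [C1 [eta1 [b1 [eta10 H1]]]]] := exceed_late' bx.
have [C2 [eta2 [b2 [eta20 H2]]]] := exceed_early' n1 bx.
have [n3 [C3 [eta3 [b3 [n30 eta30 H3]]]]] := pr_all_below' yb.
have ae1 := borel_cantelli_expR eta10
  (fun b => measurable_some_exceed mI _ _ (fun i => n1 * b + i)%N b) H1.
have ae2 := borel_cantelli_expR eta20
  (fun b => measurable_some_exceed mI _ _ id b) H2.
have ae3 := borel_cantelli_expR eta30
  (measurable_all_below l mI lam n3 (beta - e)) H3.
apply: filterS3 ae1 ae2 ae3 => w [c1 L1] [c2 L2] [c3 L3].
have [n0 Hn0] := bc_large lam_gt0 (maxn (maxn c1 c2) (maxn c3 1)).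
exists n0.+1 => n nn; have := Hn0 n (ltnW nn); set b := bc _ n.
rewrite !geq_max => /andP[/andP[bc1 bc2] /andP[bc3 bpos]].
have npos : (0 < n)%N by exact: leq_ltn_trans nn.
have /andP[en ne] := bc_bounds lam_gt0 npos.
apply/andP; split; last first.
  apply: maxV_le => // k; rewrite -/b => kn; rewrite ltNge; apply/negP => Hk.
  have [kl|kg] := ltnP k (n1 * b); first by apply: (L2 b bc2); exists k.
  apply: (L1 b bc1); exists (k - n1 * b)%N; last by rewrite subnKC.
  (* The late starts are at most [n < expR (lam (b + 1))], uniformly over the [n] that share [b]. *)
  rewrite /last_start ltnS truncn_ge_nat ?expR_ge0//.
  apply: le_trans (ltW ne); rewrite ler_nat.
  by apply: (leq_trans (leq_subr _ _)); apply: (leq_trans kn); exact: leq_subr.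
have := L3 b bc3; rewrite /all_below/= => /existsNP[s] /negP; rewrite -leNgt.
set N := windows _ _ _ _ in s *; set h := (n3 * b)%N => Hs.
apply: (maxV_ge _ _ Hs) => //; rewrite -/b.
(* The last window ends by [(l + 2) N h <= expR (lam b) <= n], so the window found is one of those
   in the maximum. *)
have bh : (b <= h)%N by rewrite /h leq_pmull.
have : ((l + 2) * (N * h) <= n)%N.
  by rewrite -(ler_nat R); exact: le_trans (windows_le l lam h b) en.
have : (s * h + h <= N * h)%N by rewrite addnC -mulSn leq_mul2r ltn_ord orbT.
move: (s * h)%N (N * h)%N => v u vu lu.
rewrite leq_subRL; last by apply: leq_trans lu; rewrite mulnDl; lia.
by apply: leq_trans lu; rewrite mulSn mulnDl; lia.
Qed.

(** Tolerances [1 / (i + 1)] suffice, so only countably many null sets are discarded. *)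
Lemma maxV_cvg :
  {ae P, forall w, (fun n => maxV F X lam^-1 n w) @ \oo --> beta}.
Proof.
have H (i : nat) : {ae P, forall w, exists n0, forall n, (n0 <= n)%N ->
    beta - i.+1%:R^-1 <= maxV F X lam^-1 n w <= beta + i.+1%:R^-1}.
  by apply: maxV_near; rewrite invr_gt0.
have := ae_foralln H; apply: filterS => w Hw.
apply/cvgrPdist_le => e e0.
have [i0 Hi0] := exists_nat_ge e^-1.
have [n0 Hn0] := Hw i0; exists n0 => // n nn.
have ie : i0.+1%:R^-1 <= e.
  by rewrite invf_ple ?posrE// ltW// Hi0.
have /andP[h1 h2] := Hn0 n nn.
rewrite /= ler_norml; apply/andP; split.
  by rewrite lerBrDl addrC -lerBrDl opprK; apply: (le_trans h2); rewrite lerD2l.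
by rewrite lerBlDl -lerBlDr; apply: le_trans h1; rewrite lerD2l lerN2.
Qed.

End erdos_renyi.

Theorem corollary2p2 (R : realType) (d : measure_display)
  (Omega : measurableType d) (P : probability Omega R)
  (p l : nat) (hp : (1 <= p)%N) (hl : (1 <= l)%N)
  (X : nat -> {RV P >-> p.-tuple R})
  (hstat : stationary P (fun k => X k : Omega -> p.-tuple R))
  (F : l.-tuple (p.-tuple R) -> R)
  (hFborel : measurable_fun setT F)
  (hFbounded : exists D : R, forall x, `|F x| <= D)
  (Fm : \bar int -> \bar int -> set (set Omega))
  (hFm : monotone_sigma_algebras Fm)
  (kappa1 : R) (hkappa1 : 0 < kappa1)
  (hmix : forall n : nat,
     (psi P Fm n <= (kappa1^-1 * expR (- kappa1 * n%:R))%:E)%E)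
  (hcenter : iterated_integral (distribution P (X 1%N)) F = 0)
  (hreg : regularityA Fm (fun k => X k : Omega -> p.-tuple R) \/
          regularityB P Fm (fun k => X k : Omega -> p.-tuple R) F)
  (d' : measure_display) (Omega' : measurableType d')
  (Q : probability Omega' R)
  (Y : 'I_l -> nat -> {RV Q >-> p.-tuple R})
  (hcopies : forall i, same_law P Q
     (fun k => X k : Omega -> p.-tuple R)
     (fun k => Y i k : Omega' -> p.-tuple R))
  (hindep : independent_processes Q
     (fun i k => Y i k : Omega' -> p.-tuple R))
  (Pi : R -> R) (hPi : admissible_Pi Pi)
  (hexp : exponential_moments Q F
     (fun i k => Y i k : Omega' -> p.-tuple R) Pi)
  (beta : R) (hbeta_gt0 : 0 < beta) (hbeta_lt : (beta%:E < beta0 Pi)%E) :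
  let c := (fine (rate Pi beta))^-1 in
  {ae P, forall w,
     (fun n => maxV F (fun k => X k : Omega -> p.-tuple R) c n w)
       @ \oo --> beta}.
Proof.
have mX k : measurable_fun setT (X k : Omega -> p.-tuple R) by exact: measurable_funP.
have mY j k : measurable_fun setT (Y j k : Omega' -> p.-tuple R) by exact: measurable_funP.
have [D hD] := hFbounded.
have bF x : `|F x| <= `|D| by apply: le_trans (hD x) (ler_norm D).
have happ : approximable P F Fm (fun k => X k : Omega -> p.-tuple R).
  case: hreg => [hA|hB]; first exact: regularityA_approximable.
  exact: regularityB_approximable.
pose S := copies_sum F (fun i k => Y i k : Omega' -> p.-tuple R).
have mS b : measurable_fun setT (S b) by exact: measurable_copies_sum.
have bS b w : `|S b w| <= `|D| * b%:R by exact: copies_sum_le.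
have hmgf := exponential_moments_mgf hexp.
have Pi0 := Pi_zero hmgf.
have lam0 := speed_gt0 hPi Pi0 hbeta_gt0 hbeta_lt.
pose tail x b := pr Q [set w | x * b%:R <= S b w].
have tail1 x b : tail x b <= 1 by apply: pr_le1; exact: measurable_level.
have mI := measurable_incr hFborel mX.
have ID k a b w : incr F (fun k => X k : Omega -> p.-tuple R) k (a + b) w =
    incr F (fun k => X k : Omega -> p.-tuple R) k a w +
    incr F (fun k => X k : Omega -> p.-tuple R) (k + a) b w.
  by rewrite /incr addnA; ring.
have bI k b w : `|incr F (fun k => X k : Omega -> p.-tuple R) k b w| <= `|D| * b%:R.
  rewrite /incr SigmaB; apply: (le_trans (ler_norm_sum _ _ _)).
  rewrite (_ : `|D| * b%:R = \sum_(i < b) `|D|); first exact: ler_sum.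
  by rewrite sumr_const card_ord mulr_natr.
have up := incr_upper hFborel mX mY hstat hcopies hindep hFm hkappa1 hmix happ.
have low := incr_lower hFborel mX mY hstat hcopies hindep hFm hkappa1 hmix happ.
have s_up := speed_upper mS bS hmgf hPi hbeta_gt0 hbeta_lt.
have s_low := speed_lower mS bS hmgf hPi hbeta_gt0 hbeta_lt.
have s_pos := positive_level mS bS hmgf hPi hbeta_gt0 hbeta_lt.
apply: (@maxV_cvg _ _ _ P p l F _ beta (speed Pi beta) lam0).
- exact: (exceed_late mI up lam0 s_up).
- move=> x n bx; apply: (exceed_early mI ID (normr_ge0 D) bI up s_pos).
  exact: lt_trans bx.
- exact: (pr_all_below lam0 tail1 hkappa1 low s_low).
- exact: mI.
Qed.
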